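(* Under the setting and standing assumptions described in the context, the quadratic form $(\mathscr E,\mathscr F)$ is a Dirichlet form on $L^2(I_0,\mathfrak m)$ in the wide sense, i.e. it is a non-negative symmetric closed form on $L^2(I_0,\mathfrak m)$ satisfying the Markovian property (it is not required to be densely defined).
   Context: Let $-\infty\le l<0<r\le\infty$ and $I=[l,r]\subset[-\infty,\infty]$. Let $\mathbf s$ be a non-constant increasing (not necessarily strictly increasing, not necessarily left or right continuous) real-valued function on $(l,r)$ with $\mathbf s(0-)=\mathbf s(0)=\mathbf s(0+)=0$; set $\mathbf s(l):=\lim_{x\downarrow l}\mathbf s(x)$, $\mathbf s(r):=\lim_{x\uparrow r}\mathbf s(x)$ (possibly infinite) and $\mathbf s(l-):=\mathbf s(l)$, $\mathbf s(r+):=\mathbf s(r)$. Let $\mathfrak m$ be a positive measure on $I$ with $\mathfrak m([a,b])<\infty$ for every $[a,b]\subset(l,r)$ and $\mathfrak m(\{0\})=0$ ($\mathfrak m(\{l\}),\mathfrak m(\{r\})$ may be infinite). Let $U$ be the set of $x\in I$ such that $\mathbf s$ is constant on $(x-\varepsilon,x+\varepsilon)\cap I$ for some $\varepsilon>0$, and write $U\setminus\{l,r\}=\bigcup_{n\ge1}(c_n,d_n)$ as a disjoint union of open intervals. Let $D^\pm:=\{x\in I:\mathbf s(x)\neq\mathbf s(x\pm)\}$, $D^0:=D^+\cap D^-$, $D:=D^+\cup D^-$. The interval $(c_n,d_n)$ is called isolated if $c_n,d_n\in D\cup\{l,r\}$. The endpoint $r$ is approachable if $\mathbf s(r)<\infty$;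 an approachable $r$ is regular if $\mathfrak m((r-\varepsilon,r))<\infty$ for some $\varepsilon>0$; a regular $r$ is reflecting if $\mathfrak m(\{r\})<\infty$. Analogously $l$ is approachable if $\mathbf s(l)>-\infty$, regular if moreover $\mathfrak m((l,l+\varepsilon))<\infty$ for some $\varepsilon>0$, reflecting if moreover $\mathfrak m(\{l\})<\infty$. Standing assumptions: (DK) if $l$ or $r$ is an endpoint of an isolated interval $(c_n,d_n)$, then it is reflecting; (DM) $I\setminus U\subset\operatorname{supp}[\mathfrak m]$, $\mathfrak m(\{x\})>0$ for every $x\in D^0$, and for every isolated interval $(c_n,d_n)$, $\mathfrak m(I^{d_n}_{c_n})>0$, where $I^{d_n}_{c_n}$ is the interval with endpoints $c_n,d_n$ which contains $c_n$ whenever $c_n\notin D^+$ and contains $d_n$ whenever $d_n\notin D^-$. The form: let $\mu_d^+:=\sum_{x\in I}(\mathbf s(x+)-\mathbf s(x))\delta_x$, $\mu_d^-:=\sum_{x\in I}(\mathbf s(x)-\mathbf s(x-))\delta_x$; $\mathbf s_d^+(x):=\mu_d^+((0,x))$ for $x\ge0$ and $-\mu_d^+([x,0))$ for $x<0$; $\mathbf s_d^-(x):=\mu_d^-((0,x])$ for $x\ge0$ and $-\mu_d^-((x,0))$ for $x<0$; $\mathbf s_c:=\mathbf s-\mathbf s_d^+-\mathbf s_d^-$, which is continuous and increasing, with Lebesgue–Stieltjes measure $\mu_c$. With the conventions $\int_{(0,x)}:=-\int_{[x,0)}$ and $\int_{(0,x]}:=-\int_{(x,0)}$ for $x<0$,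 let $\mathscr S_d^+$ be the set of functions $f(x)=\int_{(0,x)}g\,d\mu_d^+$, $x\in(l,r)$, with $g\in L^2(I,\mu_d^+)$; $\mathscr S_d^-$ the set of $f(x)=\int_{(0,x]}g\,d\mu_d^-$ with $g\in L^2(I,\mu_d^-)$; $\mathscr S_c$ the set of $f(x)=c_0+\int_{(0,x)}g\,d\mu_c$ with $g\in L^2(I,\mu_c)$, $c_0\in\mathbb R$; in each case write $df/d\mu:=g$. Let $\mathscr S:=\mathscr S_c+\mathscr S_d^++\mathscr S_d^-$; each $f\in\mathscr S$ decomposes uniquely as $f=f^c+f^++f^-$. Each $f\in\mathscr S$ has finite one-sided limits on $(l,r)$, and a finite limit $f(r):=\lim_{x\uparrow r}f(x)$ (resp. $f(l):=\lim_{x\downarrow l}f(x)$) when $r$ (resp. $l$) is approachable. Let $I_0$ be the interval obtained from $I$ by removing the endpoints that are not reflecting, and regard $\mathfrak m$ as a measure on $I_0$. Define $\mathscr F:=\{f\in\mathscr S\cap L^2(I_0,\mathfrak m): f(j)=0 \text{ whenever } j\in\{l,r\},\ j\notin I_0 \text{ and } j \text{ is approachable}\}$ and for $f,g\in\mathscr F$, $\mathscr E(f,g):=\frac12\Big(\int_I\frac{df^c}{d\mu_c}\frac{dg^c}{d\mu_c}d\mu_c+\int_I\frac{df^+}{d\mu_d^+}\frac{dg^+}{d\mu_d^+}d\mu_d^++\int_I\frac{df^-}{d\mu_d^-}\frac{dg^-}{d\mu_d^-}d\mu_d^-\Big)$. *)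

(* Defs.v *)
From HB Require Import structures.
From mathcomp Require Import all_boot all_order all_algebra.
From mathcomp Require Import all_classical all_reals all_analysis.
From Stdlib Require Import ClassicalEpsilon.
Import Order.TTheory GRing.Theory Num.Theory.
Import numFieldNormedType.Exports.

Set Implicit Arguments.
Unset Strict Implicit.
Unset Printing Implicit Defensive.

Local Open Scope classical_set_scope.
Local Open Scope ring_scope.

Definition Iopen {R : realType} (l r : \bar R) : set R :=
  [set x : R | (l < x%:E < r)%E].

Definition Iclosed {R : realType} (l r : \bar R) : set (\bar R) :=
  [set x : \bar R | (l <= x <= r)%E].

Definition sright {R : realType} (s : R -> R) (x : R) : R :=
  lim (s y @[y --> x^'+]).
Definition sleft {R : realType} (s : R -> R) (x : R) : R :=
  lim (s y @[y --> x^'-]).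

Definition to_left_end {R : realType} (l : \bar R) : set_system R :=
  match l with EFin a => a^'+ | _ => @ninfty_nbhs R end.
Definition to_right_end {R : realType} (r : \bar R) : set_system R :=
  match r with EFin b => b^'- | _ => @pinfty_nbhs R end.

Definition s_at_l {R : realType} (l : \bar R) (s : R -> R) : \bar R :=
  lim ((s x)%:E @[x --> to_left_end l]).
Definition s_at_r {R : realType} (r : \bar R) (s : R -> R) : \bar R :=
  lim ((s x)%:E @[x --> to_right_end r]).

Definition f_at_l {R : realType} (l : \bar R) (f : R -> R) : R :=
  lim (f x @[x --> to_left_end l]).
Definition f_at_r {R : realType} (r : \bar R) (f : R -> R) : R :=
  lim (f x @[x --> to_right_end r]).

(* D^+, D^- (as subsets of R; the endpoints l, r never belong to D^+-
   because of the conventions s(l-) = s(l) = s(l+) := lim_{x↓l} s(x) etc.) *)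
Definition Dplus {R : realType} (l r : \bar R) (s : R -> R) : set R :=
  [set x | Iopen l r x /\ s x <> sright s x].
Definition Dminus {R : realType} (l r : \bar R) (s : R -> R) : set R :=
  [set x | Iopen l r x /\ s x <> sleft s x].
Definition Dzero {R : realType} (l r : \bar R) (s : R -> R) : set R :=
  Dplus l r s `&` Dminus l r s.

Definition eDplus {R : realType} (l r : \bar R) (s : R -> R) : set (\bar R) :=
  [set x | exists2 a, x = a%:E & Dplus l r s a].
Definition eDminus {R : realType} (l r : \bar R) (s : R -> R) : set (\bar R) :=
  [set x | exists2 a, x = a%:E & Dminus l r s a].

Definition inU {R : realType} (l r : \bar R) (s : R -> R) (x : \bar R) : Prop :=
  Iclosed l r x /\
  exists N : set (\bar R), nbhs x N /\
    (forall y z : R, Iopen l r y -> N y%:E -> Iopen l r z -> N z%:E ->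
       s y = s z).

Definition Ucomponent {R : realType} (l r : \bar R) (s : R -> R)
    (c d : \bar R) : Prop :=
  [/\ (l <= c < d)%E, (d <= r)%E,
      (forall y : R, (c < y%:E < d)%E -> inU l r s y%:E),
      (c = l \/ ~ inU l r s c) & (d = r \/ ~ inU l r s d)].

Definition isolated_comp {R : realType} (l r : \bar R) (s : R -> R)
    (c d : \bar R) : Prop :=
  (c = l \/ c = r \/ eDplus l r s c \/ eDminus l r s c) /\
  (d = l \/ d = r \/ eDplus l r s d \/ eDminus l r s d).

(* The speed measure m on I = [l, r] is encoded by its restriction
   mi to the open interval (l, r) (a measure on R vanishing outside (l, r))
   together with the two (possibly infinite) point masses ml = m({l}),
   mr = m({r}).  measI computes m(A) for A a set of extended reals. *)
Definition measI {R : realType} (l r : \bar R) (mi : {measure set R -> \bar R})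
    (ml mr : \bar R) (A : set (\bar R)) : \bar R :=
  (mi [set y : R | Iopen l r y /\ A y%:E]
   + (if `[< A l >] then ml else 0) + (if `[< A r >] then mr else 0))%E.

Definition in_suppI {R : realType} (l r : \bar R) (mi : {measure set R -> \bar R})
    (ml mr : \bar R) (x : \bar R) : Prop :=
  Iclosed l r x /\
  forall N : set (\bar R), nbhs x N -> (0 < measI l r mi ml mr N)%E.

Definition Icd {R : realType} (l r : \bar R) (s : R -> R) (c d : \bar R) :
    set (\bar R) :=
  [set x | (c < x < d)%E \/ (x = c /\ ~ eDplus l r s c)
                         \/ (x = d /\ ~ eDminus l r s d)].

Definition approachable_l {R : realType} (l : \bar R) (s : R -> R) : Prop :=
  (-oo < s_at_l l s)%E.
Definition approachable_r {R : realType} (r : \bar R) (s : R -> R) : Prop :=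
  (s_at_r r s < +oo)%E.
Definition regular_l {R : realType} (l r : \bar R) (s : R -> R)
    (mi : {measure set R -> \bar R}) : Prop :=
  approachable_l l s /\
  exists2 c : R, Iopen l r c & (mi [set x : R | (l < x%:E)%E /\ (x < c)%R] < +oo)%E.
Definition regular_r {R : realType} (l r : \bar R) (s : R -> R)
    (mi : {measure set R -> \bar R}) : Prop :=
  approachable_r r s /\
  exists2 c : R, Iopen l r c & (mi [set x : R | (c < x)%R /\ (x%:E < r)%E] < +oo)%E.
Definition reflecting_l {R : realType} (l r : \bar R) (s : R -> R)
    (mi : {measure set R -> \bar R}) (ml : \bar R) : Prop :=
  regular_l l r s mi /\ (ml < +oo)%E.
Definition reflecting_r {R : realType} (l r : \bar R) (s : R -> R)
    (mi : {measure set R -> \bar R}) (mr : \bar R) : Prop :=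
  regular_r l r s mi /\ (mr < +oo)%E.

(* jump parts of s and continuous part s_c, given the jump measures
   mup = mu_d^+ and mum = mu_d^- *)
Definition sd_plus {R : realType} (mup : {measure set R -> \bar R}) (x : R) : R :=
  if 0 <= x then fine (mup [set y | 0 < y < x])
  else - fine (mup [set y | x <= y < 0]).
Definition sd_minus {R : realType} (mum : {measure set R -> \bar R}) (x : R) : R :=
  if 0 <= x then fine (mum [set y | 0 < y <= x])
  else - fine (mum [set y | x < y < 0]).
Definition s_cont {R : realType} (s : R -> R)
    (mup mum : {measure set R -> \bar R}) (x : R) : R :=
  s x - sd_plus mup x - sd_minus mum x.

Definition L2mu {R : realType} (mu : {measure set R -> \bar R}) (g : R -> R) : Prop :=
  measurable_fun setT g /\ (\int[mu]_x ((g x) ^+ 2)%:E < +oo)%E.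

Definition prim_open {R : realType} (mu : {measure set R -> \bar R})
    (g : R -> R) (x : R) : R :=
  if 0 <= x then Rintegral mu [set y | 0 < y < x] g
  else - Rintegral mu [set y | x <= y < 0] g.

Definition prim_closed {R : realType} (mu : {measure set R -> \bar R})
    (g : R -> R) (x : R) : R :=
  if 0 <= x then Rintegral mu [set y | 0 < y <= x] g
  else - Rintegral mu [set y | x < y < 0] g.

(* decomposition data (c0, df^c/dmu_c, df^+/dmu_d^+, df^-/dmu_d^-) of
   f = f^c + f^+ + f^- in S = S_c + S_d^+ + S_d^- *)
Definition decomp {R : realType} (l r : \bar R)
    (muc mup mum : {measure set R -> \bar R}) (f : R -> R)
    (t : R * (R -> R) * (R -> R) * (R -> R)) : Prop :=
  let: (c0, gc, gp, gm) := t in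
  [/\ L2mu muc gc, L2mu mup gp, L2mu mum gm &
      forall x, Iopen l r x ->
        f x = (c0 + prim_open muc gc x) + prim_open mup gp x
              + prim_closed mum gm x].

Definition inS {R : realType} (l r : \bar R)
    (muc mup mum : {measure set R -> \bar R}) (f : R -> R) : Prop :=
  exists t, decomp l r muc mup mum f t.

(* a chosen decomposition (the decomposition of the paper is unique) *)
Definition the_decomp {R : realType} (l r : \bar R)
    (muc mup mum : {measure set R -> \bar R}) (f : R -> R) :
    R * (R -> R) * (R -> R) * (R -> R) :=
  epsilon (inhabits (0, (fun _ => 0), (fun _ => 0), (fun _ => 0)))
          (decomp l r muc mup mum f).

Definition energyE {R : realType} (l r : \bar R)
    (muc mup mum : {measure set R -> \bar R}) (f h : R -> R) : R :=
  let: (_, fc, fp, fm) := the_decomp l r muc mup mum f in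
  let: (_, hc, hp, hm) := the_decomp l r muc mup mum h in
  2^-1 * (Rintegral muc setT (fun x => fc x * hc x)
          + Rintegral mup setT (fun x => fp x * hp x)
          + Rintegral mum setT (fun x => fm x * hm x)).

(* L^2(I_0, m): square integrability on I_0 (the boundary atoms carry
   finite mass at reflecting endpoints and boundary values are finite) *)
Definition L2I0 {R : realType} (l r : \bar R)
    (mi : {measure set R -> \bar R}) (f : R -> R) : Prop :=
  measurable_fun (Iopen l r) f /\
  (\int[mi]_(x in Iopen l r) ((f x) ^+ 2)%:E < +oo)%E.

(* inner product of L^2(I_0, m); the extension of f to a reflecting
   endpoint j is f(j) *)
Definition ipI0 {R : realType} (l r : \bar R) (s : R -> R)
    (mi : {measure set R -> \bar R}) (ml mr : \bar R) (f h : R -> R) : R :=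
  Rintegral mi (Iopen l r) (fun x => f x * h x)
  + (if `[< reflecting_l l r s mi ml >]
     then f_at_l l f * f_at_l l h * fine ml else 0)
  + (if `[< reflecting_r l r s mi mr >]
     then f_at_r r f * f_at_r r h * fine mr else 0).

Definition aeqI0 {R : realType} (l r : \bar R) (s : R -> R)
    (mi : {measure set R -> \bar R}) (ml mr : \bar R) (f h : R -> R) : Prop :=
  [/\ {ae mi, forall x, Iopen l r x -> f x = h x},
      (reflecting_l l r s mi ml -> (0 < ml)%E -> f_at_l l f = f_at_l l h) &
      (reflecting_r l r s mi mr -> (0 < mr)%E -> f_at_r r f = f_at_r r h)].

Definition domF {R : realType} (l r : \bar R) (s : R -> R)
    (mi : {measure set R -> \bar R}) (ml mr : \bar R)
    (muc mup mum : {measure set R -> \bar R}) (f : R -> R) : Prop :=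
  [/\ inS l r muc mup mum f, L2I0 l r mi f,
      (approachable_l l s -> ~ reflecting_l l r s mi ml -> f_at_l l f = 0) &
      (approachable_r r s -> ~ reflecting_r l r s mi mr -> f_at_r r f = 0)].

(* Dirichlet form in the wide sense on L^2(I_0, m) (Fukushima-Oshima-
   Takeda): a non-negative definite symmetric bilinear form (E, F) on a
   (not necessarily dense) linear subspace F of L^2(I_0, m), which is
   closed and Markovian.  F is given by representatives, so we also
   require that E only depends on m-a.e. classes. *)
Definition dirichlet_form_wide {R : realType}
    (F : (R -> R) -> Prop) (E : (R -> R) -> (R -> R) -> R)
    (inL2 : (R -> R) -> Prop) (ip : (R -> R) -> (R -> R) -> R)
    (aeq : (R -> R) -> (R -> R) -> Prop) : Prop :=
  [/\
   (forall f, F f -> inL2 f) /\ F (fun _ => 0) /\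
   (forall (a : R) f g, F f -> F g -> F (fun x => a * f x + g x)),
   (* E is well defined on m-a.e. classes *)
   (forall f, F f -> aeq f (fun _ => 0) -> E f f = 0),
   (forall f g, F f -> F g -> E f g = E g f) /\
   (forall (a : R) f g h, F f -> F g -> F h ->
      E (fun x => a * f x + g x) h = a * E f h + E g h) /\
   (forall f, F f -> 0 <= E f f),
   (forall u : nat -> R -> R, (forall n, F (u n)) ->
      (forall e : R, 0 < e -> exists N : nat, forall n k : nat,
         (N <= n)%N -> (N <= k)%N ->
         E (fun x => u n x - u k x) (fun x => u n x - u k x)
         + ip (fun x => u n x - u k x) (fun x => u n x - u k x) < e) ->
      exists2 v, F v &
        (fun n => E (fun x => u n x - v x) (fun x => u n x - v x)
                  + ip (fun x => u n x - v x) (fun x => u n x - v x))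
          @ \oo --> (0 : R)) &
   (forall u, F u -> exists2 v, F v &
      aeq v (fun x => Num.min (Num.max 0 (u x)) 1) /\ E v v <= E u u)].

(* Main.v *)
(** The idea is to read the three integrals defining the form as one. Put the
measures mu_c, mu_d^+ and mu_d^- on three copies of the line, and call cell of
x <= y the set made of [x, y) in the first two copies and of (x, y] in the third
one; it has total mass s(y) - s(x). Then f belongs to S exactly when f(y) - f(x) is
the integral over the cell of x and y of a square integrable density G, this G is
unique, and E(f, f) is half the squared norm of G. In particular
|f(y) - f(x)|^2 <= 2 E(f, f) |s(y) - s(x)|.

Closedness: since s is not constant, m charges some bounded interval, so f(0)^2 is
controlled by E(f, f) + (f, f); along a Cauchy sequence the densities converge in L2
and the functions converge pointwise, also at the approachable endpoints, and Fatou's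
lemma gives the convergence in L2(m).

Markov property: let |v(y) - v(x)| <= |u(y) - u(x)|, and let G be the density of u.
For finitely many points, multiplying G on each cell by the ratio of the increments of
v and u gives a function bounded by |G| with the right integrals for v. These
constraints form a directed family of convex sets, whose nearly minimal elements
converge, by the parallelogram identity, to a density of v of norm at most that of G.

Independence of m-classes: f is constant on the components of U, and one-sidedly
continuous off D^0. If f(x) <> 0 on a component (c, d), then either an endpoint is a
continuity point of s outside U, near which m charges the set where f does not vanish,
or (c, d) is isolated and (DM) applies. So f vanishes on U, and then everywhere. *)
Require Import Defs.
From HB Require Import structures.
From mathcomp Require Import all_boot all_order all_algebra.
From mathcomp Require Import all_classical all_reals all_analysis.
From mathcomp Require Import measurable_realfun ring lra.
Import Order.TTheory GRing.Theory Num.Theory.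
Import numFieldNormedType.Exports.
Local Open Scope classical_set_scope.
Local Open Scope ring_scope.

Set Implicit Arguments.
Unset Strict Implicit.

(** * Square integrable functions *)

Section L2.
Context d (T : measurableType d) (R : realType) (mu : {measure set T -> \bar R}).
Context (D : set T) (mD : measurable D).
Implicit Types f g h : T -> R.

(** Functions rather than classes modulo null sets, as the form is given on representatives. With
    [D] the whole space this unfolds to [L2mu], with [D] the open interval to [L2I0]. *)
Definition isL2 f :=
  measurable_fun D f /\ (\int[mu]_(x in D) ((f x) ^+ 2)%:E < +oo)%E.
Definition ip2 f g : R := Rintegral mu D (fun x => f x * g x).

Lemma isL2_sqr f : isL2 f -> mu.-integrable D (EFin \o (fun x => f x ^+ 2)).
Proof.
move=> [mf fi]; apply/integrableP; split.
  by apply/measurable_EFinP; apply: measurable_funX.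
under eq_integral do rewrite /= ger0_norm ?sqr_ge0//.
exact: fi.
Qed.

Lemma isL2_le f g : measurable_fun D f -> (forall x, D x -> `|f x| <= `|g x|) ->
  isL2 g -> isL2 f.
Proof.
move=> mf fg [mg gi]; split => //; apply: le_lt_trans gi.
apply: ge0_le_integral => //.
- by move=> x _; rewrite lee_fin sqr_ge0.
- by apply/measurable_EFinP; apply: measurable_funX.
- by apply/measurable_EFinP; apply: measurable_funX.
- move=> x Dx; rewrite lee_fin -(real_normK (num_real (f x))).
  by rewrite -(real_normK (num_real (g x))) lerXn2r ?nnegrE// fg.
Qed.

(** The product is dominated by f^2 + g^2. *)
Lemma isL2_mul f g : isL2 f -> isL2 g ->
  mu.-integrable D (EFin \o (fun x => f x * g x)).
Proof.
move=> f2 g2.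
apply: (@le_integrable _ _ _ _ _ mD _
  (EFin \o (fun x => f x ^+ 2 + g x ^+ 2))) => //.
- by apply/measurable_EFinP; apply: measurable_funM; [case: f2|case: g2].
- move=> x Dx /=; rewrite lee_fin [leRHS]ger0_norm ?addr_ge0 ?sqr_ge0//.
  rewrite normrM -(real_normK (num_real (f x))) -(real_normK (num_real (g x))).
  have := sqr_ge0 (`|f x| - `|g x|); have := normr_ge0 (f x).
  have := normr_ge0 (g x); nra.
- by apply: (integrableD mD (isL2_sqr f2) (isL2_sqr g2)).
Qed.

Lemma isL2_lin (a : R) f g : isL2 f -> isL2 g -> isL2 (fun x => a * f x + g x).
Proof.
move=> f2 g2; have mh : measurable_fun D (fun x => a * f x + g x).
  apply: measurable_funD; last by case: g2.
  by apply: measurable_funM; [exact: measurable_cst|case: f2].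
split => //.
have : mu.-integrable D (EFin \o (fun x => a ^+ 2 * f x ^+ 2
    + (2 * a * (f x * g x) + g x ^+ 2))).
  apply: (integrableD mD (f := EFin \o (fun x => a ^+ 2 * f x ^+ 2))
    (g := EFin \o (fun x => 2 * a * (f x * g x) + g x ^+ 2))).
    exact: (integrableZl mD (a ^+ 2) (isL2_sqr f2)).
  apply: (integrableD mD (f := EFin \o (fun x => 2 * a * (f x * g x)))
    (g := EFin \o (fun x => g x ^+ 2))).
    exact: (integrableZl mD (2 * a) (isL2_mul f2 g2)).
  exact: isL2_sqr g2.
move=> /(integrable_lty mD) /=; apply: le_lt_trans.
by rewrite le_eqVlt; apply/orP; left; apply/eqP/eq_integral => x _; congr EFin; ring.
Qed.

Lemma isL2B f g : isL2 f -> isL2 g -> isL2 (fun x => f x - g x).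
Proof.
move=> f2 g2; have := isL2_lin (-1) g2 f2.
by rewrite (_ : (fun x => -1 * g x + f x) = (fun x => f x - g x))//; apply/funext =>
  x; ring.
Qed.

Lemma isL20 : isL2 (fun=> 0).
Proof.
split; first exact: measurable_cst.
by under eq_integral do rewrite expr0n/=; rewrite integral0.
Qed.

Lemma ip2C f g : ip2 f g = ip2 g f.
Proof. by congr Rintegral; apply/funext => x; rewrite mulrC. Qed.

Lemma ip2_lin a f g h : isL2 f -> isL2 g -> isL2 h ->
  ip2 (fun x => a * f x + g x) h = a * ip2 f h + ip2 g h.
Proof.
move=> f2 g2 h2; rewrite /ip2 -RintegralZl//; last exact: isL2_mul.
rewrite -RintegralD//.
- by congr Rintegral; apply/funext => x; ring.
- exact: (integrableZl mD a (isL2_mul f2 h2)).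
- exact: isL2_mul.
Qed.

Lemma ip2_ge0 f : 0 <= ip2 f f.
Proof. by apply: Rintegral_ge0 => x _; rewrite -expr2 sqr_ge0. Qed.

Lemma ip2_sqr_lin a f g : isL2 f -> isL2 g ->
  ip2 (fun x => a * f x + g x) (fun x => a * f x + g x) =
  a ^+ 2 * ip2 f f + 2 * a * ip2 f g + ip2 g g.
Proof.
move=> f2 g2; have fg2 := isL2_lin a f2 g2.
rewrite ip2_lin// !(ip2C _ (fun x => a * f x + g x)) !ip2_lin// (ip2C g f).
by ring.
Qed.

Lemma ip2_sqrB f g : isL2 f -> isL2 g ->
  ip2 (fun x => f x - g x) (fun x => f x - g x) =
  ip2 f f - 2 * ip2 f g + ip2 g g.
Proof.
move=> f2 g2; have := ip2_sqr_lin (-1) g2 f2.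
rewrite (_ : (fun x => -1 * g x + f x) = (fun x => f x - g x)).
  by move=> ->; rewrite (ip2C g f); ring.
by apply/funext => x; ring.
Qed.

Lemma ip2_CS f g : isL2 f -> isL2 g -> ip2 f g ^+ 2 <= ip2 f f * ip2 g g.
Proof.
move=> f2 g2; have H a : 0 <= a ^+ 2 * ip2 f f + 2 * a * ip2 f g + ip2 g g.
  by rewrite -ip2_sqr_lin// ip2_ge0.
have F0 := ip2_ge0 f; have G0 := ip2_ge0 g.
have [F|F] := eqVneq (ip2 f f) 0.
  rewrite F mul0r; have [->|B0] := eqVneq (ip2 f g) 0; first by rewrite expr0n.
  (* With [ip2 f f = 0] the polynomial [H] is affine in its variable; at this point it equals -
     [ip2 g g] - 2 < 0. *)
  have := H (- (ip2 g g + 1) / ip2 f g).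
  rewrite F mulr0 add0r -mulrA divfK// => K; exfalso; move: K G0; lra.
have FP : 0 < ip2 f f by rewrite lt_neqAle eq_sym F F0.
(* The minimiser of the quadratic polynomial. *)
have := H (- ip2 f g / ip2 f f).
rewrite (_ : _ + _ = (ip2 f f * ip2 g g - ip2 f g ^+ 2) / ip2 f f); last by field.
by rewrite pmulr_lge0 ?invr_gt0// subr_ge0.
Qed.

End L2.

(** * Fatou's lemma and Cauchy-Schwarz on sets of finite mass *)

Section L2_limits.
Context d (T : measurableType d) (R : realType) (mu : {measure set T -> \bar R}).
Context (D : set T) (mD : measurable D).
Implicit Types f g h : T -> R.
Local Notation L2 := (isL2 mu D).
Local Notation B := (ip2 mu D).

Lemma integral_sqrE f : L2 f -> (\int[mu]_(x in D) ((f x) ^+ 2)%:E)%E = (B f f)%:E.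
Proof.
by move=> f2; rewrite /ip2 /Rintegral fineK//; apply: integrable_fin_num;
  [|exact: isL2_sqr].
Qed.

(** Fatou's lemma as lower semicontinuity of the squared norm under pointwise convergence. It serves
    the completeness of L2 and, later, the closedness of the form. *)
Lemma isL2_fatou (f_ : nat -> T -> R) f e : (forall n, L2 (f_ n)) ->
  (forall x, D x -> f_ ^~ x @ \oo --> f x) ->
  (\forall n \near \oo, B (f_ n) (f_ n) <= e) -> L2 f /\ B f f <= e.
Proof.
move=> f2 fx fe.
have mf : measurable_fun D f.
  by apply: (measurable_fun_cvg _ fx) => n; case: (f2 n).
have H : (\int[mu]_(x in D) ((f x) ^+ 2)%:E <= e%:E)%E.
  have mf2 n : measurable_fun D (fun x => ((f_ n x) ^+ 2)%:E).
    by apply/measurable_EFinP; apply: measurable_funX; case: (f2 n).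
  have f0 n x : D x -> (0 <= ((f_ n x) ^+ 2)%:E)%E by rewrite lee_fin sqr_ge0.
  rewrite (eq_integral (fun x => limn_einf (fun n => ((f_ n x) ^+ 2)%:E))).
    apply: (le_trans (fatou mu mD mf2 f0)).
    rewrite limn_einf_lim; apply: lime_le; first exact: is_cvg_einfs.
    near=> n; apply: (@le_trans _ _ (\int[mu]_(x in D) ((f_ n x) ^+ 2)%:E)%E).
      by apply: ereal_inf_lbound; exists n => /=.
    by rewrite integral_sqrE// lee_fin; near: n.
  move=> x /set_mem Dx; apply/esym; apply: (cvg_limn_einf_sup _).1.
  apply: cvg_EFin; first exact: nearW.
  exact: (cvgM (fx x Dx) (fx x Dx)).
have L : L2 f by split=> //; apply: le_lt_trans H _; rewrite ltry.
by split=> //; move: H; rewrite integral_sqrE// lee_fin.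
Unshelve. all: by end_near. Qed.

Lemma ip2_ae f f' g g' : L2 f -> L2 f' -> L2 g -> L2 g' ->
  {ae mu, forall x, D x -> f x = f' x} -> {ae mu, forall x, D x -> g x = g' x} ->
  B f g = B f' g'.
Proof.
move=> f2 f'2 g2 g'2 ff gg; rewrite /ip2 /Rintegral; congr fine.
apply: ae_eq_integral => //.
- by case/integrableP: (isL2_mul mD f2 g2).
- by case/integrableP: (isL2_mul mD f'2 g'2).
- by apply: filterS2 ff gg => x A A' Dx; rewrite (A Dx) (A' Dx).
Qed.

(** Makes integration over a set of finite mass an inner product with its indicator, so that
    [ip2_CS] bounds integrals over cells. *)
Lemma ip2_indic A g : d.-measurable A -> A `<=` D -> (mu A < +oo)%E -> L2 g ->
  [/\ L2 \1_A, B \1_A \1_A = fine (mu A) & B \1_A g = Rintegral mu A g].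
Proof.
move=> mA AD Afin g2.
have iA : forall x, (\1_A x : R) ^+ 2 = \1_A x.
  by move=> x; rewrite indicE; case: (_ \in _); rewrite ?expr1n ?expr0n.
have EA : (\int[mu]_(x in D) ((\1_A x : R) ^+ 2)%:E = mu A)%E.
  by under eq_integral do rewrite iA; rewrite integral_indic// setIidl.
split.
- by split=> //; rewrite EA.
- by rewrite /ip2 /Rintegral EA.
- rewrite /ip2 Rintegral_mkcond [RHS]Rintegral_mkcond; congr Rintegral.
  apply/funext => x; rewrite !patchE indicE.
  case: (boolP (x \in A)) => xA; last by rewrite mul0r if_same.
  by rewrite mul1r ifT//; apply/mem_set/AD/set_mem.
Qed.

Lemma integrable_sub A g : d.-measurable A -> A `<=` D -> (mu A < +oo)%E -> L2 g ->
  mu.-integrable A (EFin \o g).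
Proof.
move=> mA AD Afin g2; have [A2 _ _] := ip2_indic mA AD Afin g2.
have := integrableS mD mA AD (isL2_mul mD A2 g2).
apply: eq_integrable => // x xA; rewrite /= indicE xA mul1r//.
Qed.

Lemma Rintegral_CS A g : d.-measurable A -> A `<=` D -> (mu A < +oo)%E -> L2 g ->
  (Rintegral mu A g) ^+ 2 <= fine (mu A) * B g g.
Proof.
by move=> mA AD Afin g2; have [A2 <- <-] := ip2_indic mA AD Afin g2; exact: ip2_CS.
Qed.

End L2_limits.

(** * Completeness of L2 and limits of directed families of convex sets *)

Section L2_complete.
Context d (T : measurableType d) (R : realType) (mu : {measure set T -> \bar R}).
Context (D : set T) (mD : measurable D).
Implicit Types f g h : T -> R.
Local Notation L2 := (isL2 mu D).
Local Notation B := (ip2 mu D).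
Local Notation q f := (B f f).

(** The increments are at most a constant times 2^-k, so the telescoping series converges
    absolutely. *)
Lemma cvg_of_weighted_square_sum (a : nat -> R) (M : R) :
  (forall k, 4 ^+ k * (a k.+1 - a k) ^+ 2 <= M) -> cvgn a.
Proof.
move=> aM; have M0 : 0 <= M.
  by apply: le_trans (aM 0%N); rewrite expr0 mul1r sqr_ge0.
(* [M + 1] stands in for the square root of [M]: M <= (M + 1)^2. *)
have H k : `|a k.+1 - a k| <= geometric (M + 1) 2^-1 k.
  rewrite /= -(@ler_pXn2r _ 2) ?nnegrE ?mulr_ge0 ?exprn_ge0 ?addr_ge0//.
  rewrite real_normK ?num_real// exprMn exprVn exprVn -exprM mulnC exprM.
  rewrite -(_ : 4 = 2 ^+ 2 :> R); last by ring.
  rewrite ler_pdivlMr ?exprn_gt0// mulrC; apply: le_trans (aM k) _.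
  by rewrite sqrrD; nra.
have : cvgn (series (telescope a)).
  apply: normed_cvg; apply: (series_le_cvg _ _ H) => //.
    by move=> n; rewrite /= mulr_ge0 ?exprn_ge0 ?addr_ge0//.
  by apply: is_cvg_geometric_series; rewrite ger0_norm ?invr_ge0// invf_lt1// ltr1n.
rewrite telescopeK => ca.
rewrite (_ : a = (fun n => (a n - a 0%N) + a 0%N)); last by apply/funext => n;
  rewrite subrK.
by apply: is_cvgD => //; exact: is_cvg_cst.
Qed.

(** The series of the functions 4^k (G_(k+1) - G_k)^2 has integral at most the sum of the 2^-(k+1),
    so it is finite almost everywhere. [A] is the set where it is finite, and
    [cvg_of_weighted_square_sum] applies at its points. *)
Lemma L2_subsequence_ae (G : nat -> T -> R) : (forall n, L2 (G n)) ->
  (forall k, q (fun x => G k.+1 x - G k x) <= (2 ^ (k + 1))%:R^-1 / 4 ^+ k) ->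
  exists A, [/\ measurable A, A `<=` D, {ae mu, forall x, D x -> A x} &
    forall x, A x -> cvgn (G ^~ x)].
Proof.
move=> G2 Gle.
pose h k x := (4 ^+ k * (G k.+1 x - G k x) ^+ 2)%:E.
have mh k : measurable_fun D (h k).
  apply/measurable_EFinP; apply: measurable_funM; first exact: measurable_cst.
  apply: measurable_funX; apply: measurable_funB; [by case: (G2 k.+1)|by case: (G2 k)].
have h0 k x : D x -> (0 <= h k x)%E.
  by move=> _; rewrite /h lee_fin mulr_ge0 ?sqr_ge0 ?exprn_ge0.
pose H x := (\sum_(k <oo) h k x)%E.
have mH : measurable_fun D H.
  by apply: (ge0_emeasurable_sum (P := xpredT)) => // k x Dx _; exact: h0.
have H0 x : D x -> (0 <= H x)%E by move=> Dx; apply: nneseries_ge0 => n _ _; exact: h0.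
have iH : mu.-integrable D H.
  apply/integrableP; split=> //.
  rewrite (eq_integral H); last by move=> x /set_mem Dx; rewrite gee0_abs// H0.
  rewrite integral_nneseries//.
  apply: (@le_lt_trans _ _ (\sum_(k <oo) (1 / (2 ^ (k + 1))%:R)%:E)%E); last first.
    by rewrite (cvg_lim _ (@cvg_geometric_eseries_half R 1 0))// ltry.
  apply: lee_nneseries => k _; first by move=> _; apply: integral_ge0 => x; exact: h0.
  have d2 := isL2B mD (G2 k.+1) (G2 k).
  rewrite /h (eq_integral (fun x => (4 ^+ k)%:E * ((G k.+1 x - G k x) ^+ 2)%:E)%E)//.
  rewrite ge0_integralZl_EFin//.
  - rewrite integral_sqrE// -EFinM lee_fin div1r.
    by rewrite mulrC -ler_pdivlMr ?exprn_gt0// Gle.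
  - by move=> x _; rewrite lee_fin sqr_ge0.
  - by apply/measurable_EFinP; apply: measurable_funX; case: d2.
exists (D `&` [set x | H x \is a fin_num]); split => //.
- exact: emeasurable_fin_num.
- by apply: filterS (integrable_ae mD iH) => x Hx Dx; split => //; exact: Hx.
- move=> x [Dx /= Hx]; apply: (@cvg_of_weighted_square_sum _ (fine (H x))) => k.
  rewrite -lee_fin fineK//.
  have := @nneseries_lim_ge R (fun k => h k x) xpredT 0%N k.+1 (fun n _ _ => h0 n x Dx).
  apply: le_trans; rewrite big_nat_recr//= leeDr//.
  by apply: sume_ge0 => i _; exact: h0.
Qed.

(** The Riesz-Fischer argument: a fast subsequence converges almost everywhere, and Fatou's lemma
    along it bounds the distance of the whole sequence to the limit. *)
Lemma L2_complete (G : nat -> T -> R) : (forall n, L2 (G n)) ->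
  (forall e, 0 < e -> exists N, forall n k, (N <= n)%N -> (N <= k)%N ->
     q (fun x => G n x - G k x) <= e) ->
  exists2 G0, L2 G0 & forall e, 0 < e ->
    exists N, forall n, (N <= n)%N -> q (fun x => G n x - G0 x) <= e.
Proof.
move=> G2 cG.
have e0 k : 0 < (2 ^ (k + 1))%:R^-1 / 4 ^+ k :> R.
  by rewrite divr_gt0 ?invr_gt0 ?ltr0n ?expn_gt0 ?exprn_gt0.
have [N NP] := choice (fun k => cG _ (e0 k)).
(* The sum puts both [phi k] and [phi k.+1] beyond [N k]; the summand [k] makes [phi] tend to
   infinity. *)
pose phi k := (k + \sum_(i < k.+1) N i)%N.
have phiN k : (N k <= phi k)%N /\ (N k <= phi k.+1)%N.
  rewrite /phi; split; first by rewrite big_ord_recr/= addnA leq_addl.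
  rewrite 2!big_ord_recr/=; apply: (leq_trans _ (leq_addl _ _)).
  by apply: (leq_trans _ (leq_addr _ _)); exact: leq_addl.
have [A [mA AD aeA cA]] := L2_subsequence_ae (fun k => G2 (phi k))
  (fun k => NP k _ _ (phiN k).2 (phiN k).1).
(* Setting the functions to 0 off [A] changes them on a null set only and makes the subsequence
   converge at every point of [D], as Fatou's lemma above requires. *)
pose F n := G n \_ A.
have mF f : L2 f -> L2 (f \_ A).
  move=> f2; apply: (@isL2_le _ _ _ _ _ mD _ f) => //.
  - apply/measurable_restrict => //; apply: measurable_funS (f2.1) => //.
  - by move=> x _; rewrite patchE; case: ifP => _; rewrite ?normr0.
have aeF f : {ae mu, forall x, D x -> f x = (f \_ A) x}.
  by apply: filterS aeA => x Ax Dx; rewrite patchE mem_set//; exact: Ax.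
pose G0 x := limn (fun k => F (phi k) x).
have cF x : D x -> F (phi k) x @[k --> \oo] --> G0 x.
  move=> Dx; suff : cvgn (fun k => F (phi k) x) by [].
  have [xA|xA] := pselect (A x).
    rewrite (_ : (fun k => _) = (fun k => G (phi k) x)); first exact: cA.
    by apply/funext => k; rewrite /F patchE mem_set.
  rewrite (_ : (fun k => _) = cst 0); first exact: is_cvg_cst.
  by apply/funext => k; rewrite /F patchE memNset.
have FB n k : q (fun x => F n x - F k x) = q (fun x => G n x - G k x).
  have L : L2 (fun x => F n x - F k x) by apply: isL2B => //; exact: mF.
  have L' : L2 (fun x => G n x - G k x) by apply: isL2B.
  have E : {ae mu, forall x, D x -> F n x - F k x = G n x - G k x}.
    by apply: filterS2 (aeF (G n)) (aeF (G k)) => x a b Dx; rewrite (a Dx) (b Dx).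
  exact: ip2_ae.
have H e N' : 0 < e -> (forall n k, (N' <= n)%N -> (N' <= k)%N ->
     q (fun x => G n x - G k x) <= e) -> forall n, (N' <= n)%N ->
     L2 (fun x => F n x - G0 x) /\ q (fun x => F n x - G0 x) <= e.
  move=> ep NP' n Nn.
  apply: (isL2_fatou mD (f_ := fun k x => F n x - F (phi k) x)).
  - by move=> k; apply: isL2B => //; exact: mF.
  - by move=> x Dx; apply: cvgB; [exact: cvg_cst|exact: cF].
  - exists N' => // k /= Nk; rewrite FB; apply: NP' => //.
    by rewrite (leq_trans Nk)// leq_addr.
have G02 : L2 G0.
  have [N1 N1P] := cG _ (@ltr01 R).
  have [L _] := H _ _ (@ltr01 R) N1P N1 (leqnn _).
  have := isL2B mD (mF _ (G2 N1)) L; congr isL2.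
  by apply/funext => x; rewrite opprB addrC subrK.
exists G0 => // e /[dup] ep /cG [N' NP']; exists N' => n Nn.
have [L Le] := H _ _ ep NP' n Nn.
have E : {ae mu, forall x, D x -> G n x - G0 x = F n x - G0 x}.
  by apply: filterS (aeF (G n)) => x a Dx; rewrite (a Dx).
by rewrite (ip2_ae mD _ _ _ _ E E)//; exact: isL2B.
Qed.


Lemma ip2_sqrZ a f : L2 f -> q (fun x => a * f x) = a ^+ 2 * q f.
Proof.
move=> f2; rewrite /ip2 -RintegralZl//; last exact: isL2_mul.
by congr Rintegral; apply/funext => x; ring.
Qed.

Lemma ip2_sqrD_le f g : L2 f -> L2 g ->
  q (fun x => f x + g x) <= 2 * q f + 2 * q g.
Proof.
move=> f2 g2; have := ip2_ge0 mu D (fun x => f x - g x).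
have := ip2_sqr_lin mD 1 f2 g2; rewrite ip2_sqrB//.
rewrite (_ : (fun x => 1 * f x + g x) = (fun x => f x + g x)).
  by move=> ->; lra.
by apply/funext => x; rewrite mul1r.
Qed.

(** Expand q(g) around [f]: the square of the difference is non-negative, and by Cauchy-Schwarz the
    cross term is small. *)
Lemma ip2_le_of_approx f b : L2 f ->
  (forall e, 0 < e -> exists g, [/\ L2 g, q g <= b & q (fun x => g x - f x) <= e]) ->
  q f <= b.
Proof.
move=> f2 H; apply/ler_addgt0Pr => e e0.
have F0 := ip2_ge0 mu D f.
(* Chosen so that Cauchy-Schwarz bounds the inner product of [f] and g - f by e / 2; the + 1 covers
   q(f) = 0. *)
have d0 : 0 < (e / 2) ^+ 2 / (q f + 1)
  by rewrite divr_gt0 ?exprn_gt0 ?divr_gt0// ltr_wpDl.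
have [g [g2 gb gf]] := H _ d0.
have L := isL2B mD g2 f2.
have CS : ip2 mu D f (fun x => g x - f x) ^+ 2 <= (e / 2) ^+ 2.
  apply: le_trans (ip2_CS mD f2 L) _.
  move: gf; rewrite ler_pdivlMr ?ltr_wpDl//; apply: le_trans.
  by have := ip2_ge0 mu D (fun x => g x - f x); nra.
have fg : q g = q f + 2 * ip2 mu D f (fun x => g x - f x) + q (fun x => g x - f x).
  have := ip2_sqr_lin mD 1 f2 L.
  rewrite (_ : (fun x => 1 * f x + (g x - f x)) = g); last first.
    by apply/funext => x; rewrite mul1r addrC subrK.
  by move=> ->; ring.
have := ip2_ge0 mu D (fun x => g x - f x).
have : - (e / 2) <= ip2 mu D f (fun x => g x - f x).
  have e20 : 0 <= e / 2 by rewrite divr_ge0// ltW.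
  by move: CS; rewrite -[X in X <= _]real_normK ?num_real// ler_pXn2r ?nnegrE// =>
    /ler_normlP[]; lra.
lra.
Qed.

(* Nearly minimal elements of the sets K P are close to one another by the
   parallelogram identity, as the minimal norms are almost maximal. *)
Lemma convex_directed_L2_limit (X : Type) (K : seq X -> (T -> R) -> Prop) (b : R) :
  (forall P f, K P f -> L2 f /\ q f <= b) ->
  (forall P Q f, K (P ++ Q) f -> K P f /\ K Q f) ->
  (forall P f g, K P f -> K P g -> K P (fun x => 2^-1 * (f x + g x))) ->
  (forall P, exists f, K P f) ->
  exists G, [/\ L2 G, q G <= b &
    forall P e, 0 < e -> exists2 f, K P f & q (fun x => f x - G x) <= e].
Proof.
move=> KL Kcat Kmid Kne.
pose S P := [set q f | f in K P].
have Sinf P : has_inf (S P).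
  split; first by have [f Kf] := Kne P; exists (q f), f.
  by exists 0 => _ [f _ <-]; exact: ip2_ge0.
(* Larger lists mean more constraints and larger minimal norms; [b] keeps their supremum finite. *)
pose m := sup (range (fun P => inf (S P))).
have Ssup : has_sup (range (fun P => inf (S P))).
  split; first by exists (inf (S [::])), [::].
  exists b => _ [P _ <-]; have [f Kf] := Kne P.
  by apply: le_trans (KL _ _ Kf).2; apply: ge_inf; [exact: (Sinf P).2|exists f].
have near_min P e : 0 < e -> exists2 f, K P f & q f <= m + e.
  move=> e0; have [_ [f Kf <-] fe] := inf_adherent e0 (Sinf P).
  exists f => //; apply: (le_trans (ltW fe)); rewrite lerD2r.
  by apply: sup_ubound; [exact: Ssup.2|exists P].
have near_max e : 0 < e -> exists P, m - e <= inf (S P).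
  by move=> e0; have [_ [P _ <-] Pe] := sup_adherent e0 Ssup; exists P; exact: ltW.
(* The midpoint of [f] and [g] is in [K P], so q(f - g) = 2 q(f) + 2 q(g) - 4 q((f + g) / 2) is at
   most 4 (m + e) - 4 (m - e). *)
have close P e f g : m - e <= inf (S P) -> K P f -> K P g ->
    q f <= m + e -> q g <= m + e -> q (fun x => f x - g x) <= 8 * e.
  move=> Pe Kf Kg fe ge; have [f2 _] := KL _ _ Kf; have [g2 _] := KL _ _ Kg.
  have : m - e <= q (fun x => 2^-1 * (f x + g x)).
    apply: le_trans Pe _; apply: ge_inf; first exact: (Sinf P).2.
    by eexists; [exact: Kmid Kf Kg|].
  have := ip2_sqr_lin mD 1 f2 g2.
  rewrite (_ : (fun x => 1 * f x + g x) = (fun x => f x + g x)).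
    move=> E; rewrite ip2_sqrZ ?E ?ip2_sqrB//; first lra.
    have := isL2_lin mD 1 f2 g2; rewrite (_ : (fun x => 1 * f x + g x) = (fun x =>
      f x + g x))//.
    by apply/funext => x; rewrite mul1r.
  by apply/funext => x; rewrite mul1r.
have e0 n : 0 < n.+1%:R^-1 :> R by rewrite invr_gt0.
have [P PP] := choice (fun n => near_max _ (e0 n)).
have [F FP] := choice (fun n => let: ex_intro2 f a b := near_min (P n) _ (e0 n) in
  ex_intro (fun f => K (P n) f /\ q f <= m + n.+1%:R^-1) f (conj a b)).
have F2 n : L2 (F n) by case: (FP n) => /KL[].
(* Any further constraint [Q] can be met by an element that stays close to [F n]. *)
have join n Q : exists f, [/\ K (P n) f, K Q f, q f <= m + n.+1%:R^-1
    & q (fun x => f x - F n x) <= 8 * n.+1%:R^-1].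
  have [f /Kcat[fP fQ] fe] := near_min (P n ++ Q) _ (e0 n).
  by exists f; split => //; apply: (close (P n)) => //; case: (FP n).
have small (e : R) : 0 < e -> exists n, forall k, (n <= k)%N -> k.+1%:R^-1 <= e.
  move=> ep; exists (Num.truncn e^-1) => k nk.
  rewrite -[leRHS]invrK lef_pV2 ?posrE ?invr_gt0//.
  by apply: (le_trans (ltW (truncnS_gt _))); rewrite ler_nat.
have cF e : 0 < e -> exists N, forall n k, (N <= n)%N -> (N <= k)%N ->
     q (fun x => F n x - F k x) <= e.
  move=> ep; have ep32 : 0 < e / 32 by rewrite divr_gt0.
  have [N NP] := small _ ep32.
  exists N => n k /NP nN /NP kN.
  have [f [fn fk fe fF]] := join n (P k).
  have [f2 _] := KL _ _ fn.
  have cl j : j.+1%:R^-1 <= e / 32 -> K (P j) f -> q (F j) <= m + j.+1%:R^-1 ->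
      K (P j) (F j) -> q (fun x => F j x - f x) <= 8 * (e / 32) /\
      q (fun x => f x - F j x) <= 8 * (e / 32).
    move=> je Kf Fj KF; split; apply: (close (P j)) => //;
      try (by apply: le_trans (PP j); rewrite lerD2l lerN2);
      by [apply: le_trans Fj _; rewrite lerD2l|apply: le_trans fe _; rewrite lerD2l].
  have [H1 _] := cl n nN fn (FP n).2 (FP n).1.
  have [_ H2] := cl k kN fk (FP k).2 (FP k).1.
  have := ip2_sqrD_le (isL2B mD (F2 n) f2) (isL2B mD f2 (F2 k)).
  rewrite (_ : (fun x => F n x - f x + (f x - F k x)) = (fun x => F n x - F k x));
    first lra.
  by apply/funext => x; ring.
have [G G2 GF] := L2_complete F2 cF.
have approx Q e : 0 < e -> exists2 f, K Q f & q (fun x => f x - G x) <= e.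
  move=> ep; have ep32 : 0 < e / 32 by rewrite divr_gt0.
  have [N NP] := small _ ep32.
  have ep4 : 0 < e / 4 by rewrite divr_gt0.
  have [N' N'P] := GF _ ep4.
  have := NP (N + N')%N (leq_addr _ _); have := N'P (N + N')%N (leq_addl _ _).
  set n := (N + N')%N => Gn ne; have [f [fn fQ fe fF]] := join n Q.
  exists f => //; have [f2 _] := KL _ _ fQ.
  have := ip2_sqrD_le (isL2B mD f2 (F2 n)) (isL2B mD (F2 n) G2).
  rewrite (_ : (fun x => f x - F n x + (F n x - G x)) = (fun x => f x - G x)).
    by move: fF ne Gn; move: (n.+1%:R^-1 : R) => z; lra.
  by apply/funext => x; ring.
exists G; split => //; apply: ip2_le_of_approx => // e /(approx [::])[f Kf fG].
by exists f; have [f2 fb] := KL _ _ Kf.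
Qed.

End L2_complete.

(** * Densities with respect to cells *)

Section cells.
Context d (T : measurableType d) (R : realType) (L : {measure set T -> \bar R}).
Variables (I : set R) (s : R -> R) (C : R -> R -> set T).
Hypothesis mC : forall x y, measurable (C x y).
Hypothesis CU : forall x y z, x <= y -> y <= z -> C x z = C x y `|` C y z.
Hypothesis CI : forall x y z, x <= y -> y <= z -> C x y `&` C y z = set0.
Hypothesis LC : forall x y, I x -> I y -> x <= y -> L (C x y) = (s y - s x)%:E.
Local Notation L2 := (isL2 L setT).
Local Notation q f := (ip2 L setT f f).

(** For the cells on three copies of the line, [G] holds the three derivatives df/dmu in one
    function. Only increments of [f] inside [I] matter, so the constant is left free. *)
Definition has_density (f : R -> R) (G : T -> R) : Prop :=
  forall x y, I x -> I y -> x <= y -> f y - f x = Rintegral L (C x y) G.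

Lemma cell_lty x y : I x -> I y -> x <= y -> (L (C x y) < +oo)%E.
Proof. by move=> Ix Iy xy; rewrite LC// ltry. Qed.

Lemma cell_integrable x y G : I x -> I y -> x <= y -> L2 G ->
  L.-integrable (C x y) (EFin \o G).
Proof. by move=> Ix Iy xy; apply: integrable_sub => //; exact: cell_lty. Qed.

Lemma cell_CS x y G : I x -> I y -> x <= y -> L2 G ->
  (Rintegral L (C x y) G) ^+ 2 <= (s y - s x) * q G.
Proof.
move=> Ix Iy xy G2.
have := Rintegral_CS measurableT (mC x y) (@subsetT _ _) (cell_lty Ix Iy xy) G2.
by rewrite LC.
Qed.

Lemma cellxx x : C x x = set0.
Proof. by have := CI (lexx x) (lexx x); rewrite setIid. Qed.

Lemma cell_split x y z G : I x -> I y -> I z -> x <= y -> y <= z -> L2 G ->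
  Rintegral L (C x z) G = Rintegral L (C x y) G + Rintegral L (C y z) G.
Proof.
move=> Ix Iy Iz xy yz G2; rewrite (CU xy yz) Rintegral_setU//.
  by rewrite -CU//; apply: cell_integrable => //; exact: le_trans yz.
by apply/disj_setPS; rewrite CI.
Qed.

Lemma Rintegral_lin A a f g : measurable A ->
  L.-integrable A (EFin \o f) -> L.-integrable A (EFin \o g) ->
  Rintegral L A (fun x => a * f x + g x) = a * Rintegral L A f + Rintegral L A g.
Proof.
move=> mA fi gi; rewrite RintegralD//; first by rewrite RintegralZl.
exact: (integrableZl mA a fi).
Qed.

Lemma has_density_lin a f g F G : L2 F -> L2 G -> has_density f F -> has_density g G ->
  has_density (fun x => a * f x + g x) (fun t => a * F t + G t).
Proof.
move=> F2 G2 fF gG x y Ix Iy xy.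
rewrite Rintegral_lin//; [|exact: cell_integrable..].
by rewrite -fF// -gG//; ring.
Qed.

Lemma has_density_bound f G x y : L2 G -> has_density f G -> I x -> I y -> x <= y ->
  (f y - f x) ^+ 2 <= (s y - s x) * q G.
Proof. by move=> G2 fG Ix Iy xy; rewrite fG//; exact: cell_CS. Qed.

(** * Transfer of a density from a function to its contractions *)

Section contraction.
Variables (u v : R -> R) (G : T -> R).
Hypothesis G2 : L2 G.
Hypothesis uG : has_density u G.
Hypothesis uv : forall x y, I x -> I y -> `|v y - v x| <= `|u y - u x|.

(** The convex set of candidate densities of [v] that are right on the cells between the points of
    [P]. The pointwise bound by [G] is stable under midpoints and gives the common bound on the
    norms. *)
Definition interpolates (P : seq R) (G' : T -> R) : Prop :=
  [/\ measurable_fun setT G', forall t, `|G' t| <= `|G t| &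
     forall x y, x \in P -> y \in P -> I x -> I y -> x <= y ->
       v y - v x = Rintegral L (C x y) G'].

Lemma interpolates_L2 P G' : interpolates P G' -> L2 G'.
Proof. by case=> mG' GG' _; apply: isL2_le G2. Qed.

(* Points are inserted from left to right; on the new cell the density is G times the
   ratio of the increments of v and u,
     which Rocq's x / 0 = 0 makes 0 if u does not vary. *)
Lemma interpolates_sorted P : (forall x, x \in P -> I x) ->
  sorted (fun x y => y <= x) P -> exists G', interpolates P G'.
Proof.
elim: P => [|z P IH] PI sP.
  by exists (fun=> 0); split => // t; rewrite normr0.
case: P IH PI sP => [|w P] IH PI sP.
  exists (fun=> 0); split => //; first by move=> t; rewrite normr0.
  move=> x y; rewrite !inE => /eqP -> /eqP -> _ _ _.
  by rewrite cellxx Rintegral_set0 subrr.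
have [G0 G0P] := IH (fun x xP => PI x (mem_behead (s := z :: w :: P) xP))
  (path_sorted sP).
have [mG0 G0G vG0] := G0P; have G02 := interpolates_L2 G0P.
have Iz : I z by apply: PI; rewrite mem_head.
have Iw : I w by apply: PI; rewrite !inE eqxx orbT.
have wz : w <= z by case/andP: sP.
have Pw x : x \in w :: P -> x <= w.
  rewrite inE => /predU1P[->//|xP].
  have /andP[_ sP'] := sP.
  have tr : transitive (fun x y : R => y <= x) by move=> a b c ab bc;
    exact: le_trans bc ab.
  by have /allP := order_path_min tr sP'; apply.
pose th := (v z - v w) / (u z - u w).
have thE : th * (u z - u w) = v z - v w.
  have [u0|u0] := eqVneq (u z - u w) 0; last by rewrite /th divfK.
  have := uv Iw Iz; rewrite u0 normr0 normr_le0 => /eqP ->.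
  by rewrite mulr0.
have th1 : `|th| <= 1.
  have [u0|u0] := eqVneq (u z - u w) 0; first by rewrite /th u0 invr0 mulr0 normr0.
  by rewrite /th normrM normfV ler_pdivrMr ?normr_gt0// mul1r uv.
pose G1 t := \1_(C w z) t * (th * G t) + (1 - \1_(C w z) t) * G0 t.
have G1in t : C w z t -> G1 t = th * G t.
  by move=> Ct; rewrite /G1 indicE mem_set// subrr mul0r addr0 mul1r.
have G1out t : ~ C w z t -> G1 t = G0 t.
  by move=> Ct; rewrite /G1 indicE memNset// mul0r add0r subr0 mul1r.
(* The earlier points are at most [w], so the cells between them avoid the new cell and keep their
   integrals. *)
have G1P x : x \in w :: P -> forall y, y \in w :: P -> I x -> I y -> x <= y ->
    v y - v x = Rintegral L (C x y) G1.
  move=> xP y yP Ix Iy xy; rewrite vG0//; apply: eq_Rintegral => t /set_mem Ct.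
  apply/esym/G1out => Ct'; have yw := Pw y yP.
  have : (C x w `&` C w z) t by split=> //; rewrite (CU xy yw); left.
  by rewrite CI// (le_trans xy).
have mG1 : measurable_fun setT G1.
  apply: measurable_funD; apply: measurable_funM => //.
  - by apply: measurable_funM; [exact: measurable_cst|case: G2].
  - by apply: measurable_funB => //; exact: measurable_cst.
have G1G t : `|G1 t| <= `|G t|.
  have [Ct|Ct] := pselect (C w z t); last by rewrite G1out.
  by rewrite G1in// normrM ler_piMl.
have G12 : L2 G1 by apply: isL2_le G2.
exists G1; split => // x y xP yP Ix Iy xy.
have [<-|xNy] := eqVneq x y; first by rewrite cellxx Rintegral_set0 subrr.
move: xP; rewrite in_cons => /predU1P[xz|xP].
  move: yP; rewrite in_cons => /predU1P[yz|/Pw yw]; first by rewrite xz yz eqxx in xNy.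
  by move: xNy; rewrite eq_le xy xz (le_trans yw wz).
move: yP; rewrite in_cons => /predU1P[yz|yP]; last exact: G1P.
have xw := Pw x xP.
rewrite yz (@cell_split x w z)// -G1P// ?mem_head//.
rewrite (@eq_Rintegral _ _ _ L (C w z) (fun t => th * G t)); last first.
  by move=> t /set_mem; exact: G1in.
by rewrite RintegralZl//; [rewrite -uG// thE; ring|exact: cell_integrable].
Qed.

(** The sets [interpolates P] shrink as [P] grows, so [convex_directed_L2_limit] gives [G']. For a
    single cell, [G'] is an L2 limit of functions interpolating at its two ends, and by [cell_CS]
    the integral over the cell is continuous for this convergence. *)
Lemma has_density_contraction :
  exists G', [/\ L2 G', has_density v G' & q G' <= q G].
Proof.
have [||||G' [G'2 G'q G'P]] := @convex_directed_L2_limit _ _ _ L _ measurableT R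
    interpolates (q G).
- move=> P F FP; have F2 := interpolates_L2 FP; split => //.
  rewrite -lee_fin -!integral_sqrE//; apply: ge0_le_integral => //.
  + by move=> t _; rewrite lee_fin sqr_ge0.
  + by apply/measurable_EFinP; apply: measurable_funX; case: F2.
  + by apply/measurable_EFinP; apply: measurable_funX; case: G2.
  + move=> t _; rewrite lee_fin -(real_normK (num_real (F t)))
    -(real_normK (num_real (G t))).
    by case: FP => _ FG _; rewrite lerXn2r ?nnegrE.
- by move=> P Q F [mF FG vF]; split; split => // x y xP yP; apply: vF;
    rewrite mem_cat ?xP ?yP ?orbT.
- move=> P F F' FP F'P; have F2 := interpolates_L2 FP; have F'2 := interpolates_L2 F'P.
  case: FP => mF FG vF; case: F'P => mF' F'G vF'; split.
  + by apply: measurable_funM; [exact: measurable_cst|exact: measurable_funD].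
  + move=> t; rewrite normrM ger0_norm ?invr_ge0//.
    by have := ler_normD (F t) (F' t); have := FG t; have := F'G t; lra.
  + move=> x y xP yP Ix Iy xy.
    rewrite RintegralZl ?RintegralD//; [|exact: cell_integrable..|].
      by rewrite -vF// -vF'//; field.
    apply: cell_integrable => //.
    have := isL2_lin measurableT 1 F2 F'2; congr isL2.
    by apply/funext => t; rewrite mul1r.
(* Points outside [I] carry no constraint and are dropped; the rest is sorted for the insertion
   argument. *)
- move=> P; have [||F [mF FG vF]] :=
    @interpolates_sorted (sort (fun x y => y <= x) [seq x <- P | x \in I]).
  + by move=> x; rewrite mem_sort mem_filter => /andP[/set_mem].
  + by apply: sort_sorted => x y; rewrite orbC; exact: le_total.
  + exists F; split => // x y xP yP Ix Iy; apply: vF => //.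
      by rewrite mem_sort mem_filter xP andbT mem_set.
    by rewrite mem_sort mem_filter yP andbT mem_set.
exists G'; split => // x y Ix Iy xy; apply/eqP; rewrite -subr_eq0 -sqrf_eq0.
rewrite eq_le sqr_ge0 andbT; apply/ler_addgt0Pr => e e0; rewrite add0r.
have s0 : 0 <= s y - s x by rewrite -lee_fin -LC.
have e'0 : 0 < e / (s y - s x + 1) by rewrite divr_gt0// ltr_wpDl.
have [F FP FG] := G'P [:: x; y] _ e'0; have F2 := interpolates_L2 FP.
case: FP => _ _ /(_ x y) ->//; rewrite ?inE ?eqxx ?orbT//.
rewrite -RintegralB//; [|exact: cell_integrable..].
apply: le_trans (cell_CS Ix Iy xy (isL2B measurableT F2 G'2)) _.
move: FG; rewrite ler_pdivlMr ?ltr_wpDl//.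
by have := ip2_ge0 L setT (fun t => F t - G' t); nra.
Qed.

End contraction.
End cells.

(** * Monotone functions and their jumps *)

Section open_interval.
Context (R : realType) (l r : \bar R).
Local Notation I := (Iopen l r).

Lemma Iopen_convex a b x : I a -> I b -> a <= x -> x <= b -> I x.
Proof.
move=> /andP[la _] /andP[_ br] ax xb; apply/andP; split.
  by apply: lt_le_trans la _; rewrite lee_fin.
by apply: le_lt_trans br; rewrite lee_fin.
Qed.

Lemma Iopen_lt x : I x -> exists2 a, I a & a < x.
Proof.
move=> /andP[lx xr]; suff [a la ax] : exists2 a, (l < a%:E)%E & a < x.
  by exists a => //; apply/andP; split => //; apply: lt_trans xr; rewrite lte_fin.
move: lx; case: l => [c| |] // lx.
  by exists ((c + x) / 2); move: lx; rewrite !lte_fin; lra.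
by exists (x - 1); rewrite ?ltNyr//; lra.
Qed.

Lemma Iopen_gt x : I x -> exists2 b, I b & x < b.
Proof.
move=> /andP[lx xr]; suff [a la ax] : exists2 a, (a%:E < r)%E & x < a.
  by exists a => //; apply/andP; split => //; apply: (lt_trans lx); rewrite lte_fin.
move: xr; case: r => [c| |] // xr.
  by exists ((c + x) / 2); move: xr; rewrite !lte_fin; lra.
by exists (x + 1); rewrite ?ltry//; lra.
Qed.

Lemma nbhs_Iopen x : I x -> \forall y \near x, I y.
Proof.
move=> Ix; have [a Ia ax] := Iopen_lt Ix; have [b Ib xb] := Iopen_gt Ix.
near=> y; apply: (Iopen_convex Ia Ib).
  by apply: ltW; near: y; exact: lt_nbhsr.
by apply: ltW; near: y; exact: lt_nbhsl.
Unshelve. all: by end_near. Qed.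

Lemma measurable_Iopen : measurable (I : set R).
Proof.
have mI : forall x : \bar R, measurable [set y : R | (x < y%:E)%E] /\
    measurable [set y : R | (y%:E < x)%E].
  case=> [c| |]; split.
  - rewrite (_ : [set _ | _] = `]c, +oo[%classic)//.
    by apply/seteqP; split => y /=; rewrite in_itv/= andbT lte_fin.
  - rewrite (_ : [set _ | _] = `]-oo, c[%classic); first exact: measurable_itv.
    by apply/seteqP; split => y /=; rewrite in_itv/= lte_fin.
  - by rewrite [X in measurable X](_ : _ = set0) //; rewrite predeqE => y; split.
  - by rewrite [X in measurable X](_ : _ = setT) //; rewrite predeqE => y; split =>
    //= _; exact: ltry.
  - by rewrite [X in measurable X](_ : _ = setT) //; rewrite predeqE => y; split =>
    //= _; exact: ltNyr.
  - by rewrite [X in measurable X](_ : _ = set0) //; rewrite predeqE => y; split.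
rewrite (_ : I = [set y : R | (l < y%:E)%E] `&` [set y : R | (y%:E < r)%E]).
  by apply: measurableI; [exact: (mI l).1|exact: (mI r).2].
by apply/seteqP; split => y /=; [move/andP|move=> ?; exact/andP].
Qed.

End open_interval.

(** The intervals from [lo x] to [hi x] are ordered like the points [x] and do not overlap, so their
    lengths add up to at most the length of a common container. They will be the jumps of [s] on one
    side. *)
Lemma esum_jumps_le (R : realType) (A : set R) (lo hi : R -> R) (bot top : R) :
  bot <= top ->
  (forall x, A x -> bot <= lo x) -> (forall x, A x -> hi x <= top) ->
  (forall x y, A x -> A y -> x < y -> hi x <= lo y) ->
  (\esum_(x in A) (hi x - lo x)%:E <= (top - bot)%:E)%E.
Proof.
move=> bt Alo Ahi Alohi.
(* The lower bound [c] is generalised: after the first point it moves up to [hi x]. *)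
have sorted_sum (P : seq R) : {in P, forall x, A x} -> sorted <%R P ->
    forall c, c <= top -> {in P, forall x, c <= lo x} ->
    \sum_(x <- P) (hi x - lo x) <= top - c.
  elim: P => [|x P IH] PA sP c ct Pc; first by rewrite big_nil subr_ge0.
  have Ax : A x by apply: PA; exact: mem_head.
  have PA' : {in P, forall y, A y} by move=> y yP; apply: PA; rewrite inE yP orbT.
  have : \sum_(y <- P) (hi y - lo y) <= top - hi x.
    apply: IH => //; [exact: path_sorted sP|exact: Ahi|move=> y yP].
    apply: Alohi => //; first exact: PA'.
    by have /allP := order_path_min lt_trans sP; apply.
  have := Pc x (mem_head _ _); rewrite big_cons; lra.
apply: ge_ereal_sup => _ [X [finX XA] <-].
rewrite fsbig_finite//= sumEFin lee_fin.
rewrite -(perm_big _ (permEl (perm_sort <=%R _))).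
have XE x : x \in sort <=%R (finmap.enum_fset (fset_set X)) -> A x.
  by rewrite mem_sort in_fset_set// => /set_mem /XA.
apply: sorted_sum => //.
  by rewrite lt_sorted_uniq_le sort_uniq finmap.fset_uniq sort_le_sorted.
by move=> x /XE; exact: Alo.
Qed.

(* The convention for integrals from 0 to a negative x. *)
Definition from_zero (R : realType) (phi : R -> R -> R) (x : R) : R :=
  if 0 <= x then phi 0 x else - phi x 0.

(** The sign convention is exactly what makes the increments of the primitive of an additive
    interval function equal to that function, on either side of 0. *)
Lemma from_zeroB (R : realType) (A : set R) (phi : R -> R -> R) a b :
  (forall x y z, A x -> A y -> A z -> x <= y -> y <= z ->
     phi x z = phi x y + phi y z) ->
  A 0 -> A a -> A b -> a <= b -> from_zero phi b - from_zero phi a = phi a b.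
Proof.
move=> phiD A0 Aa Ab ab; rewrite /from_zero.
case: ifPn => b0; case: ifPn => a0.
- by rewrite (phiD 0 a b)//; ring.
- by rewrite (phiD a 0 b)//; [ring|rewrite ltW// ltNge].
- by rewrite (le_trans a0 ab) in b0.
- by rewrite (phiD a b 0)//; [ring|rewrite ltW// ltNge].
Qed.

Section monotone.
Context (R : realType) (l r : \bar R) (s : R -> R).
Local Notation I := (Iopen l r).
Hypothesis s_incr : forall x y, I x -> I y -> x <= y -> s x <= s y.

Lemma sright_cvg x : I x -> s y @[y --> x^'+] --> sright s x.
Proof.
move=> Ix; have [b Ib xb] := Iopen_gt Ix; apply: nondecreasing_at_right_is_cvgr.
- near=> c; have cb : c <= b by near: c; exact: nbhs_right_ltW.
  have J y : y \in `]x, c[ -> I y.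
    by rewrite in_itv/= => /andP[xy yc]; apply: (Iopen_convex Ix Ib); lra.
  by move=> y z /J Iy /J Iz; exact: s_incr.
- near=> c; have cb : c <= b by near: c; exact: nbhs_right_ltW.
  exists (s x) => _ [y /= + <-]; rewrite in_itv/= => /andP[xy yc].
  by apply: s_incr => //; [apply: (Iopen_convex Ix Ib)|]; lra.
Unshelve. all: by end_near. Qed.

Lemma sleft_cvg x : I x -> s y @[y --> x^'-] --> sleft s x.
Proof.
move=> Ix; have [b Ib xb] := Iopen_lt Ix; apply: nondecreasing_at_left_is_cvgr.
- near=> c; have cb : b <= c by near: c; exact: nbhs_left_ge.
  have J y : y \in `]c, x[ -> I y.
    by rewrite in_itv/= => /andP[xy yc]; apply: (Iopen_convex Ib Ix); lra.
  by move=> y z /J Iy /J Iz; exact: s_incr.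
- near=> c; have cb : b <= c by near: c; exact: nbhs_left_ge.
  exists (s x) => _ [y /= + <-]; rewrite in_itv/= => /andP[xy yc].
  by apply: s_incr => //; [apply: (Iopen_convex Ib Ix)|]; lra.
Unshelve. all: by end_near. Qed.

Lemma sright_ge x : I x -> s x <= sright s x.
Proof.
move=> Ix; apply: limr_ge; first exact: sright_cvg.
near=> y; have xy : x < y by near: y; exact: nbhs_right_gt.
apply: s_incr (ltW xy) => //.
by near: y; apply: cvg_at_right_filter; [exact: cvg_id|exact: nbhs_Iopen].
Unshelve. all: by end_near. Qed.

Lemma sright_le x y : I x -> I y -> x < y -> sright s x <= s y.
Proof.
move=> Ix Iy xy; apply: limr_le; first exact: sright_cvg.
near=> z; have xz : x < z by near: z; exact: nbhs_right_gt.
have zy : z <= y by near: z; exact: nbhs_right_ltW.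
by apply: s_incr => //; apply: (Iopen_convex Ix Iy) => //; exact: ltW.
Unshelve. all: by end_near. Qed.

Lemma sleft_le x : I x -> sleft s x <= s x.
Proof.
move=> Ix; apply: limr_le; first exact: sleft_cvg.
near=> y; have xy : y < x by near: y; exact: nbhs_left_lt.
apply: s_incr (ltW xy) => //.
by near: y; apply: cvg_at_left_filter; [exact: cvg_id|exact: nbhs_Iopen].
Unshelve. all: by end_near. Qed.

Lemma sleft_ge x y : I x -> I y -> x < y -> s x <= sleft s y.
Proof.
move=> Ix Iy xy; apply: limr_ge; first exact: sleft_cvg.
near=> z; have xz : z < y by near: z; exact: nbhs_left_lt.
have zy : x <= z by near: z; exact: nbhs_left_ge.
by apply: s_incr => //; apply: (Iopen_convex Ix Iy) => //; exact: ltW.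
Unshelve. all: by end_near. Qed.

Lemma sright_approx x e : I x -> 0 < e -> exists y, [/\ I y,
  x < y & s y <= sright s x + e].
Proof.
move=> Ix e0; have /cvgrPdist_le /(_ e e0) H := sright_cvg Ix.
have [b Ib xb] := Iopen_gt Ix.
near x^'+ => y; exists y.
have xy : x < y by near: y; exact: nbhs_right_gt.
  split => //.
    by apply: (Iopen_convex Ix Ib (ltW xy)); near: y; exact: nbhs_right_ltW.
  have : `|sright s x - s y| <= e by near: y.
  by rewrite ler_norml; lra.
Unshelve. all: by end_near. Qed.

Lemma sleft_approx x e : I x -> 0 < e -> exists y, [/\ I y,
  y < x & sleft s x - e <= s y].
Proof.
move=> Ix e0; have /cvgrPdist_le /(_ e e0) H := sleft_cvg Ix.
have [b Ib xb] := Iopen_lt Ix.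
near x^'- => y; exists y.
have xy : y < x by near: y; exact: nbhs_left_lt.
  split => //.
    apply: (Iopen_convex Ib Ix _ (ltW xy)); near: y; exact: nbhs_left_ge.
  have : `|sleft s x - s y| <= e by near: y.
  by rewrite ler_norml; lra.
Unshelve. all: by end_near. Qed.

End monotone.

(** * Three copies of the line *)

Section layered_sum.
Context (R : realType) (m0 m1 m2 : {measure set R -> \bar R}).

Definition layer (i : nat) (x : R) : R * nat := (x, i).

Lemma measurable_layer i : measurable_fun setT (layer i).
Proof. exact: pair2_measurable. Qed.

Definition on_layer (i : nat) (m : {measure set R -> \bar R}) :
    {measure set (R * nat)%type -> \bar R} :=
  measure_function_pushforward__canonical__measure_function_Measure m
    (measurable_layer i).

(** The disjoint union of three measured lines, the second coordinate recording the copy. Levels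
    from 3 on are null. *)
Definition layered_sum : {measure set (R * nat)%type -> \bar R} :=
  measure_add (on_layer 0 m0) (measure_add (on_layer 1 m1) (on_layer 2 m2)).

Lemma layered_sumE A : layered_sum A =
  (m0 (layer 0 @^-1` A) + (m1 (layer 1 @^-1` A) + m2 (layer 2 @^-1` A)))%E.
Proof. by apply: (etrans (measure_addE _ _ _)); congr (_ + _)%E; exact: measure_addE.
  Qed.

Definition glue_layers (g0 g1 g2 : R -> R) (z : R * nat) : R :=
  if z.2 == 0%N then g0 z.1 else if z.2 == 1%N then g1 z.1 else g2 z.1.

Lemma measurable_glue_layers g0 g1 g2 : measurable_fun setT g0 ->
  measurable_fun setT g1 -> measurable_fun setT g2 ->
  measurable_fun setT (glue_layers g0 g1 g2).
Proof.
move=> mg0 mg1 mg2.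
have mb k : measurable_fun setT (fun z : R * nat => z.2 == k).
  by apply: (measurableT_comp (f := fun n : nat => n == k)); [|exact: measurable_snd].
apply: measurable_fun_ifT => //; first exact: measurableT_comp measurable_fst.
by apply: measurable_fun_ifT => //; exact: measurableT_comp measurable_fst.
Qed.

Lemma ge0_integral_layered_sum D (f : R * nat -> \bar R) : measurable D ->
  (forall x, (0 <= f x)%E) -> measurable_fun setT f ->
  (\int[layered_sum]_(x in D) f x =
   \int[m0]_(x in layer 0 @^-1` D) f (x, 0%N) +
   (\int[m1]_(x in layer 1 @^-1` D) f (x, 1%N) +
    \int[m2]_(x in layer 2 @^-1` D) f (x, 2%N)))%E.
Proof.
move=> mD f0 mf; have mfD := measurable_funTS mf : measurable_fun D f.
have pf i (m : {measure set R -> \bar R}) : (\int[on_layer i m]_(x in D) f x =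
    \int[m]_(x in layer i @^-1` D) f (x, i))%E.
  by apply: (ge0_integral_pushforward (measurable_layer i) m mD mfD) => x _; exact: f0.
by rewrite ge0_integral_measure_add// ge0_integral_measure_add// !pf.
Qed.

Lemma Rintegral_layered_sum D (f : R * nat -> R) : measurable D ->
  measurable_fun setT f ->
  m0.-integrable (layer 0 @^-1` D) (fun x => (f (x, 0%N))%:E) ->
  m1.-integrable (layer 1 @^-1` D) (fun x => (f (x, 1%N))%:E) ->
  m2.-integrable (layer 2 @^-1` D) (fun x => (f (x, 2%N))%:E) ->
  Rintegral layered_sum D f =
   Rintegral m0 (layer 0 @^-1` D) (fun x => f (x, 0%N)) +
   (Rintegral m1 (layer 1 @^-1` D) (fun x => f (x, 1%N)) +
    Rintegral m2 (layer 2 @^-1` D) (fun x => f (x, 2%N))).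
Proof.
move=> mD mf i0 i1 i2.
have mfE : measurable_fun setT (EFin \o f) by exact/measurable_EFinP.
have mi i (m : {measure set R -> \bar R}) :
    m.-integrable (layer i @^-1` D) (fun x => (f (x, i))%:E) ->
    (on_layer i m).-integrable D (EFin \o f).
  by move=> fi; apply: integrable_pushforward => //; exact: measurable_layer.
have mp i : measurable (layer i @^-1` D).
  by rewrite -[X in measurable X]setTI; exact: measurable_layer.
have mfD : measurable_fun D (EFin \o f) by exact: measurable_funTS.
have i12 : (measure_add (on_layer 1 m1) (on_layer 2 m2)).-integrable D (EFin \o f).
  apply/integrableP; split => //; rewrite ge0_integral_measure_add//; last first.
    exact: measurableT_comp.
  by apply: lte_add_pinfty;
    [case/integrableP: (mi _ _ i1)|case/integrableP: (mi _ _ i2)].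
rewrite /Rintegral (integral_measure_add mD (mi _ _ i0) i12).
rewrite (integral_measure_add mD (mi _ _ i1) (mi _ _ i2)).
have pf i (m : {measure set R -> \bar R}) :
    m.-integrable (layer i @^-1` D) (fun x => (f (x, i))%:E) ->
    (\int[on_layer i m]_(x in D) (f x)%:E =
    \int[m]_(x in layer i @^-1` D) (f (x, i))%:E)%E.
  by move=> fi; apply: (integral_pushforward (measurable_layer i) mfE fi mD).
rewrite !pf//.
have [F0 F1] := (integrable_fin_num (mp 0%N) i0, integrable_fin_num (mp 1%N) i1).
have F2 := integrable_fin_num (mp 2%N) i2.
rewrite (fineD F0); last by rewrite fin_numD; apply/andP.
by rewrite (fineD F1 F2).
Qed.

Lemma isL2_layered_sum F : isL2 layered_sum setT F <->
  [/\ measurable_fun setT F, isL2 m0 setT (fun x => F (x, 0%N)),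
    isL2 m1 setT (fun x => F (x, 1%N)) & isL2 m2 setT (fun x => F (x, 2%N))].
Proof.
have mFi i : measurable_fun setT F -> measurable_fun setT (fun x => F (x, i)).
  by move=> mF; apply: measurableT_comp mF (measurable_layer i).
have E : measurable_fun setT F ->
  (\int[layered_sum]_x (F x ^+ 2)%:E = \int[m0]_x (F (x, 0%N) ^+ 2)%:E +
    (\int[m1]_x (F (x, 1%N) ^+ 2)%:E + \int[m2]_x (F (x, 2%N) ^+ 2)%:E))%E.
  move=> mF; rewrite ge0_integral_layered_sum// => [x|];
    first by rewrite lee_fin sqr_ge0.
  by apply/measurable_EFinP; exact: measurable_funX.
have pos (m : {measure set R -> \bar R}) i : (0 <= \int[m]_x (F (x, i) ^+ 2)%:E)%E.
  by apply: integral_ge0 => x _; rewrite lee_fin sqr_ge0.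
split=> [[mF]|[mF [_ F0] [_ F1] [_ F2]]].
- rewrite E// => lty; split => //; split; try exact: mFi; apply: le_lt_trans lty.
  + by rewrite leeDl// adde_ge0.
  + by rewrite addeCA leeDl// adde_ge0.
  + by rewrite addeA leeDr// adde_ge0.
- by split=> //; rewrite E//; apply: lte_add_pinfty => //; exact: lte_add_pinfty.
Qed.

Lemma ip2_layered_sum F H : isL2 layered_sum setT F -> isL2 layered_sum setT H ->
  ip2 layered_sum setT F H =
   ip2 m0 setT (fun x => F (x, 0%N)) (fun x => H (x, 0%N)) +
   (ip2 m1 setT (fun x => F (x, 1%N)) (fun x => H (x, 1%N)) +
    ip2 m2 setT (fun x => F (x, 2%N)) (fun x => H (x, 2%N))).
Proof.
move=> /isL2_layered_sum[mF F0 F1 F2] /isL2_layered_sum[mH H0 H1 H2].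
rewrite /ip2 Rintegral_layered_sum//; first exact: measurable_funM.
- exact: (isL2_mul measurableT F0 H0).
- exact: (isL2_mul measurableT F1 H1).
- exact: (isL2_mul measurableT F2 H2).
Qed.

End layered_sum.

(** Bundles hypotheses of the theorem on [s] and on the measures derived from it; none of them
    involves the speed measure. *)
Record scale_measures (R : realType) (l r : \bar R) (s : R -> R)
    (muc mup mum : {measure set R -> \bar R}) : Prop := ScaleMeasures {
  l_lt0 : (l < 0)%E;
  r_gt0 : (0 < r)%E;
  scale_incr : forall x y, Iopen l r x -> Iopen l r y -> x <= y -> s x <= s y;
  scale0 : [/\ sleft s 0 = 0, s 0 = 0 & sright s 0 = 0];
  mup_esum : forall A, measurable A ->
    mup A = (\esum_(x in A `&` Iopen l r) (sright s x - s x)%:E)%E;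
  mum_esum : forall A, measurable A ->
    mum A = (\esum_(x in A `&` Iopen l r) (s x - sleft s x)%:E)%E;
  muc_out : muc (~` Iopen l r) = 0%E;
  muc_itv : forall a b, Iopen l r a -> Iopen l r b -> a < b ->
    muc [set x | (a < x <= b)%R] = (s_cont s mup mum b - s_cont s mup mum a)%:E }.

(** * Half-open intervals and removal of null sets *)

Section half_open.
Context (R : realType).
Implicit Types a b c x y : R.

(** The increment s(b) - s(a) contains the right jumps at the points of [a, b) and the left jumps at
    those of (a, b], hence the two kinds of intervals. *)
Definition co a b : set R := [set t | a <= t < b].
Definition oc a b : set R := [set t | a < t <= b].

Lemma measurable_co a b : measurable (co a b).
Proof.
rewrite (_ : co a b = `[a, b[%classic); first exact: measurable_itv.
by apply/seteqP; split => t /=; rewrite in_itv.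
Qed.

Lemma measurable_oc a b : measurable (oc a b).
Proof.
rewrite (_ : oc a b = `]a, b]%classic); first exact: measurable_itv.
by apply/seteqP; split => t /=; rewrite in_itv.
Qed.

Lemma coU a b c : a <= b -> b <= c -> co a c = co a b `|` co b c.
Proof.
move=> ab bc; apply/seteqP; split => t; rewrite /co /=.
- by move=> /andP[at' tc]; case: (ltP t b) => tb; [left|right]; rewrite ?at' ?tc.
- move=> [/andP[at' tb]|/andP[bt tc]]; apply/andP; split => //.
    exact: lt_le_trans bc.
  exact: le_trans bt.
Qed.

Lemma coI a b c : co a b `&` co b c = set0.
Proof.
apply/seteqP; split => t //; rewrite /co /= => -[/andP[_ tb] /andP[bt _]].
by have := lt_le_trans tb bt; rewrite ltxx.
Qed.

Lemma ocU a b c : a <= b -> b <= c -> oc a c = oc a b `|` oc b c.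
Proof.
move=> ab bc; apply/seteqP; split => t; rewrite /oc /=.
- by move=> /andP[at' tc]; case: (leP t b) => tb; [left|right]; rewrite ?at' ?tc.
- move=> [/andP[at' tb]|/andP[bt tc]]; apply/andP; split => //.
    exact: le_trans bc.
  exact: le_lt_trans bt.
Qed.

Lemma ocI a b c : oc a b `&` oc b c = set0.
Proof.
apply/seteqP; split => t //; rewrite /oc /= => -[/andP[_ tb] /andP[bt _]].
by have := le_lt_trans tb bt; rewrite ltxx.
Qed.

Lemma fine_measureU (m : {measure set R -> \bar R}) (A B : set R) :
  measurable A -> measurable B -> A `&` B = set0 -> (m (A `|` B) < +oo)%E ->
  fine (m (A `|` B)) = fine (m A) + fine (m B).
Proof.
move=> mA mB AB lty; have fin D : measurable D -> D `<=` A `|` B -> m D \is a fin_num.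
  move=> mD DS; rewrite ge0_fin_numE//; apply: le_lt_trans lty.
  by apply: le_measure => //; rewrite inE//; exact: measurableU.
have E := measureU m mA mB AB.
by rewrite E fineD//; apply: fin.
Qed.

Lemma measureD_null (m : {measure set R -> \bar R}) (A N : set R) :
  measurable A -> measurable N -> m N = 0%E -> m (A `\` N) = m A.
Proof.
move=> mA mN N0; have mAN := measurableD mA mN.
have E : m A = (m (A `\` N) + m (A `&` N))%E.
  rewrite -measureU//; first by rewrite setUC setUIDK.
    exact: measurableI.
  by apply/seteqP; split => t // [[_ ?] []].
rewrite E (_ : m (A `&` N) = 0%E) ?adde0//.
apply/eqP; rewrite -measure_le0 -N0; apply: le_measure; rewrite ?inE//.
exact: measurableI.
Qed.

Lemma RintegralD_null (m : {measure set R -> \bar R}) (A N : set R) g :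
  measurable A -> measurable N -> m N = 0%E -> m.-integrable A (EFin \o g) ->
  Rintegral m (A `\` N) g = Rintegral m A g.
Proof.
move=> mA mN N0 gi; rewrite /Rintegral; congr fine; apply/esym.
exact: (negligible_integral mN mA gi N0).
Qed.

End half_open.

(** * Masses of half-open intervals and of cells *)

Section scale.
Context (R : realType) (l r : \bar R) (s : R -> R)
  (muc mup mum : {measure set R -> \bar R}).
Hypothesis sm : scale_measures l r s muc mup mum.
Local Notation I := (Iopen l r).
Let s_incr := scale_incr sm.

Lemma Iopen0 : I 0.
Proof. by apply/andP; split; [exact: l_lt0 sm|exact: r_gt0 sm]. Qed.

Lemma mup1 x : I x -> mup [set x] = (sright s x - s x)%:E.
Proof.
move=> Ix; rewrite (mup_esum sm); last exact: measurable_set1.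
rewrite setIidl; last by move=> _ ->.
by rewrite esum_set1// lee_fin subr_ge0 (sright_ge s_incr).
Qed.

Lemma mum1 x : I x -> mum [set x] = (s x - sleft s x)%:E.
Proof.
move=> Ix; rewrite (mum_esum sm); last exact: measurable_set1.
rewrite setIidl; last by move=> _ ->.
by rewrite esum_set1// lee_fin subr_ge0 (sleft_le s_incr).
Qed.

Lemma mup_co a b : I a -> I b -> a <= b -> (mup (co a b) <= (s b - s a)%:E)%E.
Proof.
move=> Ia Ib ab; rewrite (mup_esum sm); last exact: measurable_co.
apply: esum_jumps_le; first exact: s_incr.
- by move=> x [/andP[ax _] Ix]; exact: s_incr.
- by move=> x [/andP[_ xb] Ix]; exact: (sright_le s_incr).
- by move=> x y [_ Ix] [_ Iy]; exact: (sright_le s_incr).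
Qed.

Lemma mum_oc a b : I a -> I b -> a <= b -> (mum (oc a b) <= (s b - s a)%:E)%E.
Proof.
move=> Ia Ib ab; rewrite (mum_esum sm); last exact: measurable_oc.
apply: esum_jumps_le; first exact: s_incr.
- by move=> x [/andP[ax _] Ix]; exact: (sleft_ge s_incr).
- by move=> x [/andP[_ xb] Ix]; exact: s_incr.
- by move=> x y [_ Ix] [_ Iy]; exact: (sleft_ge s_incr).
Qed.

Lemma mup_lty a b : I a -> I b -> a <= b -> (mup (co a b) < +oo)%E.
Proof. by move=> Ia Ib ab; apply: (le_lt_trans (mup_co Ia Ib ab)); exact: ltry. Qed.

Lemma mum_lty a b : I a -> I b -> a <= b -> (mum (oc a b) < +oo)%E.
Proof. by move=> Ia Ib ab; apply: (le_lt_trans (mum_oc Ia Ib ab)); exact: ltry. Qed.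

Lemma mup0 : mup [set 0] = 0%E.
Proof. by rewrite mup1 ?(scale0 sm)//; [case: (scale0 sm) => _ -> ->;
  rewrite subrr|exact: Iopen0]. Qed.

Lemma mum0 : mum [set 0] = 0%E.
Proof. by rewrite mum1; [case: (scale0 sm) => -> -> _; rewrite subrr|exact: Iopen0].
  Qed.

Lemma oo_co (x : R) : [set y | 0 < y < x] = co 0 x `\` [set 0].
Proof.
apply/seteqP; split => y; rewrite /co /=.
- by move=> /andP[y0 yx]; rewrite (ltW y0) yx; split => //; apply/eqP; rewrite gt_eqF.
- by move=> [/andP[y0 yx] /eqP yN0]; rewrite lt_neqAle eq_sym yN0 y0.
Qed.

Lemma oo_oc (x : R) : [set y | x < y < 0] = oc x 0 `\` [set 0].
Proof.
apply/seteqP; split => y; rewrite /oc /=.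
- by move=> /andP[xy y0]; rewrite (ltW y0) xy; split => //; apply/eqP; rewrite lt_eqF.
- by move=> [/andP[xy y0] /eqP yN0]; rewrite xy lt_neqAle yN0 y0.
Qed.

(** For x >= 0 the definition uses the open interval (0, x); it differs from [0, x) by the point 0,
    where [s] has no jump. Half-open intervals are additive, which [from_zeroB] needs. *)
Lemma sd_plusE x : sd_plus mup x = from_zero (fun a b => fine (mup (co a b))) x.
Proof.
rewrite /sd_plus /from_zero; case: ifP => // _; rewrite oo_co measureD_null//.
- exact: measurable_co.
- exact: mup0.
Qed.

Lemma sd_minusE x : sd_minus mum x = from_zero (fun a b => fine (mum (oc a b))) x.
Proof.
rewrite /sd_minus /from_zero; case: ifP => // _; rewrite oo_oc measureD_null//.
- exact: measurable_oc.
- exact: mum0.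
Qed.

Lemma muc_oc a b : I a -> I b -> a <= b ->
  muc (oc a b) = (s b - s a - fine (mup (co a b)) - fine (mum (oc a b)))%:E.
Proof.
move=> Ia Ib; rewrite le_eqVlt => /predU1P[<-|ab].
  rewrite (_ : oc a a = set0); last first.
    by apply/seteqP; split => t //=; rewrite /oc /= => /andP[/lt_le_trans /[apply]];
      rewrite ltxx.
  rewrite (_ : co a a = set0); last first.
    by apply/seteqP; split => t //=; rewrite /co /= => /andP[/le_lt_trans /[apply]];
      rewrite ltxx.
  by rewrite !measure0 /= subrr !subr0.
rewrite (muc_itv sm Ia Ib ab); congr EFin; rewrite /s_cont.
have P : sd_plus mup b - sd_plus mup a = fine (mup (co a b)).
  rewrite !sd_plusE; apply: (from_zeroB (A := I)) => //; [|exact: Iopen0|exact: ltW].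
  move=> x y z Ix Iy Iz xy yz; rewrite (coU xy yz) fine_measureU//.
  - exact: measurable_co.
  - exact: measurable_co.
  - exact: coI.
  - by rewrite -coU//; apply: mup_lty => //; exact: le_trans yz.
have M : sd_minus mum b - sd_minus mum a = fine (mum (oc a b)).
  rewrite !sd_minusE; apply: (from_zeroB (A := I)) => //; [|exact: Iopen0|exact: ltW].
  move=> x y z Ix Iy Iz xy yz; rewrite (ocU xy yz) fine_measureU//.
  - exact: measurable_oc.
  - exact: measurable_oc.
  - exact: ocI.
  - by rewrite -ocU//; apply: mum_lty => //; exact: le_trans yz.
by rewrite -P -M; ring.
Qed.

(** The continuity of s_c is derived here: the mass of (y, x] under mu_c is at most s(x) - s(y)
    minus the left jump at [x], that is s(x-) - s(y), which is small for [y] close to [x]. *)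
Lemma muc1 x : I x -> muc [set x] = 0%E.
Proof.
move=> Ix; apply/eqP; rewrite eq_le measure_ge0 andbT.
apply/lee_addgt0Pr => e e0; rewrite add0e.
have [y [Iy yx ye]] := sleft_approx s_incr Ix e0.
apply: (@le_trans _ _ (muc (oc y x))).
  apply: le_measure; rewrite ?inE; [exact: measurable_set1|exact: measurable_oc|].
  by move=> _ ->; rewrite /oc /= yx lexx.
rewrite muc_oc ?lee_fin//; last exact: ltW.
have : s x - sleft s x <= fine (mum (oc y x)).
  rewrite -lee_fin fineK -?mum1//; last by rewrite ge0_fin_numE// mum_lty// ltW.
  apply: le_measure; rewrite ?inE; [exact: measurable_set1|exact: measurable_oc|].
  by move=> _ ->; rewrite /oc /= yx lexx.
have : 0 <= fine (mup (co y x)) by rewrite fine_ge0.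
lra.
Qed.

Lemma muc_co a b : I a -> I b -> a <= b -> muc (co a b) = muc (oc a b).
Proof.
move=> Ia Ib; rewrite le_eqVlt => /predU1P[<-|ab].
  congr (muc _); apply/seteqP; split => t; rewrite /co /oc /=.
    by move=> /andP[/le_lt_trans /[apply]]; rewrite ltxx.
  by move=> /andP[/lt_le_trans /[apply]]; rewrite ltxx.
rewrite -(measureD_null (measurable_co a b) (measurable_set1 a) (muc1 Ia)).
rewrite -(measureD_null (measurable_oc a b) (measurable_set1 b) (muc1 Ib)).
congr (muc _); apply/seteqP; split => t; rewrite /co /oc /=.
- move=> [/andP[at' tb] /eqP tNa]; split; last by apply/eqP; rewrite lt_eqF.
  by rewrite (ltW tb) lt_neqAle eq_sym tNa at'.
- move=> [/andP[at' tb] /eqP tNb]; split; last by apply/eqP; rewrite gt_eqF.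
  by rewrite (ltW at') lt_neqAle tNb tb.
Qed.

(* Layers 0, 1 and 2 carry mu_c, mu_d^+ and mu_d^-. *)
Definition cell (x y : R) : set (R * nat) :=
  [set z | if z.2 == 2%N then x < z.1 <= y else x <= z.1 < y].

Lemma cell0 x y : layer 0 @^-1` cell x y = co x y. Proof. by []. Qed.
Lemma cell1 x y : layer 1 @^-1` cell x y = co x y. Proof. by []. Qed.
Lemma cell2 x y : layer 2 @^-1` cell x y = oc x y. Proof. by []. Qed.

Lemma measurable_cell x y : measurable (cell x y).
Proof.
rewrite (_ : cell x y = (oc x y `*` [set 2%N]) `|` (co x y `*` ~` [set 2%N])).
  by apply: measurableU; apply: measurableX => //;
    [exact: measurable_oc|exact: measurable_co].
apply/seteqP; split => -[t i]; rewrite /cell /oc /co /=.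
  by case: eqVneq => [->|/eqP i2] H; [left|right].
by case=> -[H i2]; [rewrite i2|move/eqP/negbTE: i2 => ->].
Qed.

Lemma cellU x y z : x <= y -> y <= z -> cell x z = cell x y `|` cell y z.
Proof.
move=> xy yz; have := coU xy yz; have := ocU xy yz.
move=> /seteqP[A A'] /seteqP[B B']; apply/seteqP.
by split => -[t i]; rewrite /cell /=; case: eqP => _;
  [exact: A|exact: B|exact: A'|exact: B'].
Qed.

Lemma cellI x y z : cell x y `&` cell y z = set0.
Proof.
have /seteqP[A _] := coI x y z; have /seteqP[B _] := ocI x y z.
apply/seteqP; split => -[t i] //; rewrite /cell /=.
by case: eqP => _; [exact: B|exact: A].
Qed.

Local Notation L := (layered_sum muc mup mum).

Lemma cell_measure x y : I x -> I y -> x <= y -> L (cell x y) = (s y - s x)%:E.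
Proof.
move=> Ix Iy xy; rewrite layered_sumE cell0 cell1 cell2 muc_co// muc_oc//.
have P : mup (co x y) \is a fin_num by rewrite ge0_fin_numE ?mup_lty.
have M : mum (oc x y) \is a fin_num by rewrite ge0_fin_numE ?mum_lty.
by rewrite -[in X in (_ + X)%E](fineK P) -[in X in (_ + (_ + X))%E](fineK M) -!EFinD;
  congr EFin; ring.
Qed.

End scale.

(** * Functions of S and their densities *)

Section densities.
Context (R : realType) (l r : \bar R) (s : R -> R)
  (muc mup mum : {measure set R -> \bar R}).
Hypothesis sm : scale_measures l r s muc mup mum.
Local Notation I := (Iopen l r).
Local Notation L := (layered_sum muc mup mum).
Local Notation L2 := (isL2 L setT).
Local Notation q f := (ip2 L setT f f).
Local Notation dens := (has_density L I (@cell R)).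
Let I0 := Iopen0 sm.
Let s_incr := scale_incr sm.
Let mC := @measurable_cell R.
Let CU := @cellU R.
Let CI x y z (_ : x <= y) (_ : y <= z) := @cellI R x y z.
Let LC := cell_measure sm.

Lemma isL2_glue_layers G0 G1 G2 : L2mu muc G0 -> L2mu mup G1 -> L2mu mum G2 ->
  L2 (glue_layers G0 G1 G2).
Proof.
move=> [m0 f0] [m1 f1] [m2 f2]; apply/isL2_layered_sum; split => //.
exact: measurable_glue_layers.
Qed.

Lemma muc_lty a b : I a -> I b -> a <= b -> (muc (co a b) < +oo)%E.
Proof. by move=> Ia Ib ab; rewrite (muc_co sm)// (muc_oc sm)// ltry. Qed.

Lemma Rintegral_cell G x y : L2 G -> I x -> I y -> x <= y ->
  Rintegral L (cell x y) G =
   Rintegral muc (co x y) (fun t => G (t, 0%N)) +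
   (Rintegral mup (co x y) (fun t => G (t, 1%N)) +
    Rintegral mum (oc x y) (fun t => G (t, 2%N))).
Proof.
move=> /isL2_layered_sum[mG G0 G1 G2] Ix Iy xy; rewrite Rintegral_layered_sum//.
- by apply: (integrable_sub measurableT _ _ _ G0) => //;
  [exact: measurable_co|exact: (muc_lty Ix Iy xy)].
- by apply: (integrable_sub measurableT _ _ _ G1) => //;
  [exact: measurable_co|exact: (mup_lty sm Ix Iy xy)].
- by apply: (integrable_sub measurableT _ _ _ G2) => //;
  [exact: measurable_oc|exact: (mum_lty sm Ix Iy xy)].
Qed.

(** The primitives and the cells differ at most by the point 0, which none of the three measures
    charges. *)
Lemma prim_sum G x : L2 G -> I x ->
  prim_open muc (fun t => G (t, 0%N)) x + prim_open mup (fun t => G (t, 1%N)) x +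
  prim_closed mum (fun t => G (t, 2%N)) x =
  from_zero (fun a b => Rintegral L (cell a b) G) x.
Proof.
move=> L2G Ix; have /isL2_layered_sum[mG G0 G1 G2] := L2G.
rewrite /prim_open /prim_closed /from_zero oo_co oo_oc.
have z1 := measurable_set1 (0 : R).
case: ifPn => [x0|]; last rewrite -ltNge => /ltW x0; rewrite Rintegral_cell//.
- rewrite !RintegralD_null//; try exact: measurable_co.
  + by rewrite addrA.
  + exact: (mup0 sm).
  + by apply: (integrable_sub measurableT _ _ _ G1) => //;
    [exact: measurable_co|exact: (mup_lty sm I0 Ix x0)].
  + exact: (muc1 sm).
  + by apply: (integrable_sub measurableT _ _ _ G0) => //;
    [exact: measurable_co|exact: (muc_lty I0 Ix x0)].
- rewrite (RintegralD_null _ _ (mum0 sm))//.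
  + by rewrite -/(co x 0); ring.
  + exact: measurable_oc.
  + by apply: (integrable_sub measurableT _ _ _ G2) => //;
    [exact: measurable_oc|exact: (mum_lty sm Ix I0 x0)].
Qed.

Lemma decomp_density f c0 g0 g1 g2 : decomp l r muc mup mum f (c0, g0, g1, g2) ->
  L2 (glue_layers g0 g1 g2) /\ dens f (glue_layers g0 g1 g2).
Proof.
move=> [L0 L1 L2' fE]; have G2 := isL2_glue_layers L0 L1 L2'; split => // x y Ix Iy xy.
have P z (Iz : I z) : prim_open muc g0 z + prim_open mup g1 z + prim_closed mum g2 z =
    from_zero (fun a b => Rintegral L (cell a b) (glue_layers g0 g1 g2)) z :=
      prim_sum G2 Iz.
have fE' z : I z -> f z = c0 + from_zero (fun a b => Rintegral L (cell a b)
  (glue_layers g0 g1 g2)) z.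
  by move=> Iz; rewrite fE// -P//; ring.
rewrite (fE' y Iy) (fE' x Ix).
rewrite -(from_zeroB (A := I) (phi := fun a b => Rintegral L (cell a b)
  (glue_layers g0 g1 g2)))//.
  by rewrite opprD addrACA subrr add0r.
by move=> a b c Ia Ib Ic ab bc; exact: (cell_split mC CU CI LC).
Qed.

Lemma density_decomp f G : L2 G -> dens f G ->
  decomp l r muc mup mum f
    (f 0, fun t => G (t, 0%N), fun t => G (t, 1%N), fun t => G (t, 2%N)).
Proof.
move=> G2 fG; have /isL2_layered_sum[mG [m0 g0] [m1 g1] [m2 g2]] := G2; split =>
  // x Ix.
rewrite -!addrA !(addrA (prim_open _ _ _)) prim_sum// /from_zero.
case: ifPn => [x0|]; last rewrite -ltNge => /ltW x0; by rewrite -fG//; ring.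
Qed.

Lemma inS_density f : inS l r muc mup mum f <-> exists2 G, L2 G & dens f G.
Proof.
split=> [[[[[c0 g0] g1] g2]] /decomp_density[? ?]|[G G2 fG]].
  by exists (glue_layers g0 g1 g2).
by eexists; exact: density_decomp fG.
Qed.

Lemma eq0_of_sqr_le (a b c : R) (C : 0 <= c) :
  (forall e, 0 < e -> a ^+ 2 <= e * c) -> a = 0.
Proof.
move=> H; apply/eqP; rewrite -sqrf_eq0 eq_le sqr_ge0 andbT.
apply/ler_addgt0Pr => e e0; rewrite add0r.
have d0 : 0 < e / (c + 1) by rewrite divr_gt0// ltr_wpDl.
apply: le_trans (H _ d0) _.
by rewrite mulrAC ler_pdivrMr ?ltr_wpDl// ler_pM2l//; lra.
Qed.

(** Cauchy-Schwarz on [A] without [z]. For cells shrinking to [z] the right-hand side tends to 0,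
    which isolates the contribution of the atom. *)
Lemma Rintegral_atom (G : R * nat -> R) z A : measurable A -> A z -> (L A < +oo)%E ->
  L2 G ->
  (Rintegral L A G - G z * fine (L [set z])) ^+ 2 <= (fine (L A) - fine (L [set z]))
    * q G.
Proof.
move=> mA Az LA G2.
have mz : measurable [set z].
  have -> : [set z] = [set z.1] `*` [set z.2].
    by case: z {Az} => a b; apply/seteqP; split => -[c d] /=; [case=> -> ->|case=> ->
      ->].
  by apply: measurableX => //; exact: measurable_set1.
have mAz := measurableD mA mz.
have LzA : (L [set z] <= L A)%E by apply: le_measure; rewrite ?inE// => _ ->.
have Lz : (L [set z] < +oo)%E := le_lt_trans LzA LA.
have AE : A = [set z] `|` (A `\` [set z]) by rewrite setDUK// => _ ->.
have dAz : [set z] `&` (A `\` [set z]) = set0.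
  by apply/seteqP; split => // w [-> []] _; apply.
have LAz : L A = (L [set z] + L (A `\` [set z]))%E by rewrite {1}AE measureU.
have LAzfin : (L (A `\` [set z]) < +oo)%E.
  by apply: le_lt_trans LA; apply: le_measure; rewrite ?inE// => w [].
have -> : fine (L A) - fine (L [set z]) = fine (L (A `\` [set z])).
  by rewrite LAz fineD ?ge0_fin_numE//; ring.
have iA := integrable_sub measurableT mA (@subsetT _ _) LA G2.
have -> : Rintegral L A G = G z * fine (L [set z]) + Rintegral L (A `\` [set z]) G.
  rewrite {1}AE Rintegral_setU//; [|by rewrite -AE|by apply/disj_setPS; rewrite dAz].
  congr (_ + _); rewrite -Rintegral_cst//; apply: eq_Rintegral => w /set_mem -> //.
rewrite addrC addKr; exact: (Rintegral_CS measurableT mAz (@subsetT _ _) LAzfin G2).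
Qed.

(** * Uniqueness of the density *)

Section uniqueness.
Variable G : R * nat -> R.
Hypothesis G2 : L2 G.
Hypothesis G_cell : forall x y, I x -> I y -> x <= y -> Rintegral L (cell x y) G = 0.

(* Cells shrinking to the right of x decrease to the single point (x, 1). *)
Lemma density_mup_atom x : I x -> G (x, 1%N) * (sright s x - s x) = 0.
Proof.
move=> Ix; apply: (@eq0_of_sqr_le _ 0 (q G)) => [|e e0]; first exact: ip2_ge0.
have [y [Iy xy ye]] := sright_approx s_incr Ix e0.
have Lx : L [set (x, 1%N)] = (sright s x - s x)%:E.
  rewrite layered_sumE (_ : layer 0 @^-1` _ = set0); last by apply/seteqP; split =>
    t // [].
  rewrite (_ : layer 2 @^-1` _ = set0); last by apply/seteqP; split => t // [].
  rewrite (_ : layer 1 @^-1` _ = [set x]); last by apply/seteqP; split => t /= [->].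
  by rewrite !measure0 add0e adde0 (mup1 sm).
have xin : cell x y (x, 1%N) by rewrite /cell /= lexx.
have := Rintegral_atom (mC x y) xin (cell_lty LC Ix Iy (ltW xy)) G2.
rewrite G_cell//; last exact: ltW.
rewrite Lx LC//; last exact: ltW.
rewrite /= sub0r sqrrN => /le_trans; apply.
by apply: ler_wpM2r; [exact: ip2_ge0|lra].
Qed.

(** Mirror image of [density_mup_atom]: cells shrinking from the left keep the point (x, 2), as
    layer 2 uses (y, x]. *)
Lemma density_mum_atom x : I x -> G (x, 2%N) * (s x - sleft s x) = 0.
Proof.
move=> Ix; apply: (@eq0_of_sqr_le _ 0 (q G)) => [|e e0]; first exact: ip2_ge0.
have [y [Iy xy ye]] := sleft_approx s_incr Ix e0.
have Lx : L [set (x, 2%N)] = (s x - sleft s x)%:E.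
  rewrite layered_sumE (_ : layer 0 @^-1` _ = set0); last by apply/seteqP; split =>
    t // [].
  rewrite (_ : layer 1 @^-1` _ = set0); last by apply/seteqP; split => t // [].
  rewrite (_ : layer 2 @^-1` _ = [set x]); last by apply/seteqP; split => t /= [->].
  by rewrite !measure0 !add0e (mum1 sm).
have xin : cell y x (x, 2%N) by rewrite /cell /= xy lexx.
have := Rintegral_atom (mC y x) xin (cell_lty LC Iy Ix (ltW xy)) G2.
rewrite G_cell//; last exact: ltW.
rewrite Lx LC//; last exact: ltW.
rewrite /= sub0r sqrrN => /le_trans; apply.
by apply: ler_wpM2r; [exact: ip2_ge0|lra].
Qed.

Lemma ip2_null_support (m : {measure set R -> \bar R}) (g : R -> R) :
  measurable_fun setT g -> m [set x | g x != 0] = 0%E -> ip2 m setT g g = 0.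
Proof.
move=> mg m0; have mN : measurable [set x | g x != 0].
  rewrite (_ : [set x | _] = g @^-1` (~` [set 0])).
    by rewrite -[X in measurable X]setTI; apply: mg => //; exact: measurableC.
  by apply/seteqP; split => x /= /eqP.
rewrite /ip2 /Rintegral (@ae_eq_integral _ _ _ m setT (cst 0%E))//.
- by rewrite integral_cst//= mul0e.
- by apply/measurable_EFinP; apply: measurable_funM.
exists [set x | g x != 0]; split => // x /= H; apply/eqP => g0; apply: H => _.
by rewrite g0 mulr0.
Qed.

(** The mass of the set where [G] does not vanish is a sum of jumps, and each of them is 0 by
    [density_mup_atom]. *)
Lemma density_mup0 : ip2 mup setT (fun t => G (t, 1%N)) (fun t => G (t, 1%N)) = 0.
Proof.
have /isL2_layered_sum[_ _ [mg _] _] := G2.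
apply: ip2_null_support => //; rewrite (mup_esum sm); last first.
  rewrite -[X in measurable X]setTI; rewrite (_ : [set x | _] = (fun t => G (t, 1%N))
    @^-1` (~` [set 0])).
    by apply: mg => //; exact: measurableC.
  by apply/seteqP; split => x /= /eqP.
apply: esum1 => x [/= Gx Ix]; congr EFin; apply/eqP.
by have /eqP := density_mup_atom Ix; rewrite mulf_eq0 (negbTE Gx).
Qed.

Lemma density_mum0 : ip2 mum setT (fun t => G (t, 2%N)) (fun t => G (t, 2%N)) = 0.
Proof.
have /isL2_layered_sum[_ _ _ [mg _]] := G2.
apply: ip2_null_support => //; rewrite (mum_esum sm); last first.
  rewrite -[X in measurable X]setTI; rewrite (_ : [set x | _] = (fun t => G (t, 2%N))
    @^-1` (~` [set 0])).
    by apply: mg => //; exact: measurableC.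
  by apply/seteqP; split => x /= /eqP.
apply: esum1 => x [/= Gx Ix]; congr EFin; apply/eqP.
by have /eqP := density_mum_atom Ix; rewrite mulf_eq0 (negbTE Gx).
Qed.

Lemma density_muc_co x y : I x -> I y -> x <= y ->
  Rintegral muc (co x y) (fun t => G (t, 0%N)) = 0.
Proof.
move=> Ix Iy xy; have /isL2_layered_sum[_ g0 g1 g2] := G2.
have := G_cell Ix Iy xy; rewrite Rintegral_cell//.
have := Rintegral_CS measurableT (measurable_co x y) (@subsetT _ _)
  (mup_lty sm Ix Iy xy) g1.
have := Rintegral_CS measurableT (measurable_oc x y) (@subsetT _ _)
  (mum_lty sm Ix Iy xy) g2.
rewrite density_mup0 density_mum0 !mulr0.
move=> H; have /eqP := le_anti (introT andP (conj H (sqr_ge0 _)));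
  rewrite sqrf_eq0 => /eqP ->.
move=> {}H; have /eqP := le_anti (introT andP (conj H (sqr_ge0 _)));
  rewrite sqrf_eq0 => /eqP ->.
by rewrite !addr0.
Qed.

(** The sets [E] over whose trace on [a, b) the integral of [g] vanishes form a Dynkin class. It
    contains the rays [x, +oo), whose traces are empty, [x, b) or all of [a, b), hence every Borel
    set. *)
Lemma ae_zero_of_co (m : {measure set R -> \bar R}) (a b : R) (g : R -> R) :
  m.-integrable (co a b) (EFin \o g) ->
  (forall x, a <= x -> x <= b -> Rintegral m (co x b) g = 0) ->
  {ae m, forall t, co a b t -> g t = 0}.
Proof.
move=> gi g0; have mD := measurable_co a b.
pose P := [set E : set R | (\int[m]_(x in co a b `&` E) (g x)%:E = 0)%E].
have giE E : measurable E -> m.-integrable (co a b `&` E) (EFin \o g).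
  by move=> mE; apply: integrableS gi => //; exact: measurableI.
have PD : (\int[m]_(x in co a b) (g x)%:E = 0)%E.
  case: (leP a b) => ab.
    have := g0 a (lexx a) ab; rewrite /Rintegral => /eqP.
    have := integrable_fin_num mD gi; rewrite /comp; case: integral =>
      // z _ /eqP /= ->//.
  rewrite (_ : co a b = set0) ?integral_set0//; apply/seteqP; split => t //.
  by rewrite /co /= => /andP[/le_lt_trans /[apply]]; rewrite ltNge (ltW ab).
have gE : @measurable _ R = <<s @RGenCInfty.G R >> := @RGenCInfty.measurableE R.
have PE : forall E : set R, measurable E -> P E.
  move=> E mE; apply: (@dynkin_induction _ R (@RGenCInfty.G R) P) => //.
  - move=> _ _ [x ->] [y ->]; exists (Num.max x y).
    by apply/seteqP; split => t /=; rewrite !in_itv/= !andbT ge_max; [move=> [->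
      ->]|move/andP].
  - by rewrite /P /= setIT.
  - move=> _ [x ->]; rewrite /P /=; have [xa|ax] := leP x a.
      rewrite (_ : _ `&` _ = co a b)//; apply/seteqP; split => t;
        rewrite /co /= in_itv/= andbT.
        by case.
      by move=> /andP[at' tb]; rewrite at' tb (le_trans xa).
    have [xb|bx] := leP x b.
      rewrite (_ : _ `&` _ = co x b).
        have := g0 x (ltW ax) xb; rewrite /Rintegral => /eqP.
        have /(integrable_fin_num (measurable_co x b)) : m.-integrable (co x b)
          (EFin \o g).
          apply: integrableS gi => //; first exact: measurable_co.
          by move=> t; rewrite /co /= => /andP[xt ->]; rewrite (le_trans (ltW ax)).
        by rewrite /comp; case: integral => // z _ /eqP /= ->.
      apply/seteqP; split => t; rewrite /co /= in_itv/= andbT.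
        by move=> [/andP[_ ->] ->].
      by move=> /andP[xt tb]; rewrite xt tb (le_trans (ltW ax)).
    rewrite (_ : _ `&` _ = set0) ?integral_set0//; apply/seteqP; split => t //.
    rewrite /co /= in_itv/= andbT => -[/andP[_ tb] xt].
    by have := lt_trans (le_lt_trans xt tb) bx; rewrite ltxx.
  - move=> S mS; rewrite /P /= => PS.
    have : (\int[m]_(x in (co a b `&` S) `|` (co a b `&` ~` S)) (g x)%:E = 0)%E.
      by rewrite -setIUr setUv setIT.
    rewrite integral_setU_EFin ?PS ?add0e//.
    + exact: measurableI.
    + by apply: measurableI => //; exact: measurableC.
    + by rewrite -setIUr setUv setIT; case/integrableP: gi => /measurable_EFinP.
    + by apply/disj_setPS => t [[_ ?] [_]].
  - move=> F mF tF PF; rewrite /P /= setI_bigcupr integral_bigcup//.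
    + by apply: eseries0 => i _ _; exact: PF.
    + exact: trivIset_setIl.
    + by move=> k; exact: measurableI.
    + by rewrite -setI_bigcupr; apply: giE; exact: bigcupT_measurable.
  by rewrite -gE.
have : ae_eq m (co a b) (EFin \o g) (cst 0%E).
  apply: integral_ae_eq => //.
  move=> E ED mE; rewrite integral0.
  by have := PE E mE; rewrite /P /= setIidr.
by apply: filterS => t /= /[apply] -[].
Qed.

Lemma density_muc0 : ip2 muc setT (fun t => G (t, 0%N)) (fun t => G (t, 0%N)) = 0.
Proof.
have /isL2_layered_sum[_ g0 _ _] := G2.
apply: ip2_null_support; first by case: g0.
have mN : measurable [set x | G (x, 0%N) != 0].
  rewrite (_ : [set x | _] = (fun t => G (t, 0%N)) @^-1` (~` [set 0])).
    by rewrite -[X in measurable X]setTI; apply: (g0.1) => //; exact: measurableC.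
  by apply/seteqP; split => x /= /eqP.
suff H : muc.-negligible [set x | G (x, 0%N) != 0] by exact: (measure_negligible mN H).
(* [muc] may be infinite on the whole interval, so the set is covered by countably many cells with
   rational end points, on each of which [G] is integrable. *)
pose F n : set R := if unpickle n is Some (p, p') then
  [set t | I (ratr p) /\ I (ratr p') /\ co (ratr p) (ratr p') t /\ G (t, 0%N)
    != 0] else set0.
apply: (@negligibleS _ _ _ _ ((~` I) `|` \bigcup_n F n)).
  move=> x /= Gx; have [Ix|] := pselect (I x); last by left.
  right; have [a Ia ax] := Iopen_lt Ix; have [b Ib xb] := Iopen_gt Ix.
  have [p] := rat_in_itvoo ax; rewrite in_itv/= => /andP[ap px].
  have [p'] := rat_in_itvoo xb; rewrite in_itv/= => /andP[xp pb].
  exists (pickle (p, p')); first exact: Logic.I.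
  rewrite /F pickleK; split; last split.
  - exact: (Iopen_convex Ia Ix (ltW ap) (ltW px)).
  - exact: (Iopen_convex Ix Ib (ltW xp) (ltW pb)).
  - by split => //; rewrite /co /= (ltW px).
apply: negligibleU.
  exists (~` I); split => //; last exact: muc_out sm.
  by apply: measurableC; exact: measurable_Iopen.
apply: negligible_bigcup => n; rewrite /F; case: unpickle => [[p p']|];
  last exact: negligible_set0.
have [[Ip [Ip' pp]]|H] := pselect (I (ratr p) /\ I (ratr p') /\ (ratr p : R)
  <= ratr p'); last first.
  apply: (@negligibleS _ _ _ _ set0); last exact: negligible_set0.
  move=> t /= [Ip [Ip' [/andP[pt tp] _]]].
  by apply: H; split => //; split => //; exact: le_trans (ltW tp).
have gi : muc.-integrable (co (ratr p) (ratr p')) (EFin \o (fun t => G (t, 0%N))).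
  by apply: (integrable_sub measurableT _ _ _ g0) => //;
    [exact: measurable_co|exact: (muc_lty Ip Ip' pp)].
have := @ae_zero_of_co muc _ _ _ gi; case.
  by move=> x px xp; apply: density_muc_co => //; exact: (Iopen_convex Ip Ip').
move=> N [mNN N0 NN]; exists N; split => // t /= [_ [_ [tc /eqP Gt]]].
by apply: NN => /= H; exact/Gt/H.
Qed.

Lemma density_unique0 : q G = 0.
Proof.
by rewrite ip2_layered_sum// density_muc0 density_mup0 density_mum0 !addr0.
Qed.

End uniqueness.
End densities.

(** * The energy in terms of densities *)

Section energy.
Context (R : realType) (l r : \bar R) (s : R -> R)
  (muc mup mum : {measure set R -> \bar R}).
Hypothesis sm : scale_measures l r s muc mup mum.
Local Notation I := (Iopen l r).
Local Notation L := (layered_sum muc mup mum).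
Local Notation L2 := (isL2 L setT).
Local Notation q f := (ip2 L setT f f).
Local Notation dens := (has_density L I (@cell R)).
Let mC := @measurable_cell R.
Let LC := cell_measure sm.

Lemma dens_lin a f g F G : L2 F -> L2 G -> dens f F -> dens g G ->
  dens (fun x => a * f x + g x) (fun t => a * F t + G t).
Proof. exact: (has_density_lin mC LC). Qed.

Lemma densB f g F G : L2 F -> L2 G -> dens f F -> dens g G ->
  dens (fun x => f x - g x) (fun t => F t - G t).
Proof.
move=> F2 G2 fF gG; have := dens_lin (-1) G2 F2 gG fF.
rewrite (_ : (fun x => -1 * g x + f x) = (fun x => f x - g x)); last first.
  by apply/funext => x; ring.
by rewrite (_ : (fun x => -1 * G x + F x) = (fun x => F x - G x))//; apply/funext =>
  x; ring.
Qed.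

Lemma dens0 c : dens (fun=> c) (fun=> 0).
Proof. by move=> x y Ix Iy xy; rewrite subrr /Rintegral integral0. Qed.

Lemma dens_bound f F x y : L2 F -> dens f F -> I x -> I y -> x <= y ->
  (f y - f x) ^+ 2 <= (s y - s x) * q F.
Proof. exact: (has_density_bound mC LC). Qed.

(** F - F' has integral 0 on every cell, hence norm 0, and Cauchy-Schwarz makes its pairing with [H]
    vanish. *)
Lemma ip2_density_unique f F F' H : L2 F -> L2 F' -> L2 H -> dens f F -> dens f F' ->
  ip2 L setT F H = ip2 L setT F' H.
Proof.
move=> F2 F'2 H2 fF fF'; have D2 := isL2B measurableT F2 F'2.
have D0 : q (fun t => F t - F' t) = 0.
  apply: (density_unique0 sm D2) => x y Ix Iy xy.
  by rewrite -(densB F2 F'2 fF fF')//; ring.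
have := ip2_CS measurableT D2 H2; rewrite D0 mul0r => K.
have /eqP := le_anti (introT andP (conj K (sqr_ge0 _))); rewrite sqrf_eq0 => /eqP {}K.
have := ip2_lin measurableT 1 D2 F'2 H2; rewrite K mulr0 add0r => <-.
by congr ip2; apply/funext => t; ring.
Qed.

(** [the_decomp] is an unspecified choice of decomposition; by uniqueness of the density any choice
    gives the same energy. *)
Lemma energyE_density f h F H : L2 F -> L2 H -> dens f F -> dens h H ->
  energyE l r muc mup mum f h = 2^-1 * ip2 L setT F H.
Proof.
move=> F2 H2 fF hH; rewrite /energyE.
have Df : decomp l r muc mup mum f (the_decomp l r muc mup mum f).
  by apply: ClassicalEpsilon.epsilon_spec; eexists; exact: (density_decomp sm F2 fF).
have Dh : decomp l r muc mup mum h (the_decomp l r muc mup mum h).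
  by apply: ClassicalEpsilon.epsilon_spec; eexists; exact: (density_decomp sm H2 hH).
case: (the_decomp l r muc mup mum f) Df =>
  [[[c0 f0] f1] f2] /(decomp_density sm)[Gf2 fG].
case: (the_decomp l r muc mup mum h) Dh =>
  [[[d0 h0] h1] h2] /(decomp_density sm)[Gh2 hG].
rewrite (ip2_density_unique F2 Gf2 H2 fF fG)
  ip2C (ip2_density_unique H2 Gh2 Gf2 hH hG) ip2C.
by rewrite (ip2_layered_sum Gf2 Gh2) addrA.
Qed.

Section endpoint.
Variables (FF : set_system R).
Context {PF : ProperFilter FF}.
Hypothesis FI : FF I.
Hypothesis sF : cvg (s x @[x --> FF]).

Lemma dens_abs_bound f F x y : L2 F -> dens f F -> I x -> I y ->
  (f y - f x) ^+ 2 <= `|s y - s x| * q F.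
Proof.
move=> F2 fF Ix Iy; wlog xy : x y Ix Iy / x <= y.
  move=> W; case: (leP x y) => [|/ltW] xy; first exact: W.
  by rewrite -sqrrN opprB distrC; exact: W.
by rewrite ger0_norm; [exact: dens_bound|rewrite subr_ge0 (scale_incr sm)].
Qed.

(** The bound of (f(y) - f(x))^2 by |s(y) - s(x)| transfers the Cauchy property from [s] to [f]. *)
Lemma density_cvg f F : L2 F -> dens f F -> cvg (f x @[x --> FF]).
Proof.
move=> F2 fF; apply/cauchy_cvgP; apply: cauchy_exP => e e0.
(* Two points within [d] of the limit give increments of [s] of at most 2 d, and 2 d q(F) < e^2. *)
pose d := e ^+ 2 / (q F + 1) / 4.
have Q0 : 0 < q F + 1 by rewrite ltr_wpDl// ip2_ge0.
have d0 : 0 < d by rewrite /d !divr_gt0// exprn_gt0.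
have /cvgrPdist_le/(_ d d0) sd := sF.
near FF => z; exists (f z).
suff : \forall x \near FF, ball (f z) e (f x) by [].
near=> x.
have Iz : I z by near: z.
have Ix : I x by near: x.
have zd : `|lim (s x @[x --> FF]) - s z| <= d by near: z.
have xd : `|lim (s x @[x --> FF]) - s x| <= d by near: x.
rewrite /ball /= -(@ltr_pXn2r _ 2) ?nnegrE ?(ltW e0)// real_normK ?num_real//.
apply: le_lt_trans (dens_abs_bound F2 fF Ix Iz) _.
apply: (@le_lt_trans _ _ (2 * d * q F)).
  apply: ler_wpM2r; first exact: ip2_ge0.
  move: zd xd; rewrite !ler_norml => /andP[? ?] /andP[? ?]; apply/andP; split; lra.
have -> : 2 * d * q F = e ^+ 2 * (q F / (q F + 1)) / 2.
  by rewrite /d; field; rewrite gt_eqF.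
have q1 : q F / (q F + 1) <= 1 by rewrite ler_pdivrMr// mul1r; lra.
have e2 : 0 < e ^+ 2 by rewrite exprn_gt0.
nra.
Unshelve. all: by end_near. Qed.

Lemma density_lim_bound f F x : L2 F -> dens f F -> I x ->
  (lim (f y @[y --> FF]) - f x) ^+ 2 <= `|lim (s y @[y --> FF]) - s x| * q F.
Proof.
move=> F2 fF Ix; have cf := density_cvg F2 fF.
have cfx : f y - f x @[y --> FF] --> lim (f y @[y --> FF]) - f x.
  by apply: cvgB => //; exact: cvg_cst.
have csx : `|s y - s x| * q F @[y --> FF] --> `|lim (s y @[y --> FF]) - s x| * q F.
  apply: cvgM; last exact: cvg_cst.
  by apply: cvg_norm; apply: cvgB => //; exact: cvg_cst.
apply: (ler_cvg_to (cvgM cfx cfx) csx).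
by near=> y; rewrite /= -expr2; apply: dens_abs_bound => //; near: y.
Unshelve. all: by end_near. Qed.

End endpoint.
End energy.

(** * Filters at the two ends of the interval *)

Section end_filters.
Context (R : realType) (l r : \bar R) (s : R -> R).
Local Notation I := (Iopen l r).
Hypotheses (l0 : (l < 0)%E) (r0 : (0 < r)%E).
Hypothesis s_incr : forall x y, I x -> I y -> x <= y -> s x <= s y.

#[export] Instance to_left_end_proper : ProperFilter (to_left_end l).
Proof. by case: l => [a| |] /=; exact: _. Qed.

#[export] Instance to_right_end_proper : ProperFilter (to_right_end r).
Proof. by case: r => [a| |] /=; exact: _. Qed.

Lemma near_left_end y : I y -> \forall x \near to_left_end l, I x /\ x < y.
Proof.
move=> Iy; suff : \forall x \near to_left_end l, (l < x%:E)%E /\ x < y.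
  apply: filterS => x [lx xy]; split => //; apply/andP; split => //.
  by case/andP: Iy => _; apply: lt_trans; rewrite lte_fin.
case/andP: Iy => + _; move: l0; case: l => [a| |] //= _.
- rewrite lte_fin => ay; near=> x; split; last by near: x; exact: nbhs_right_lt.
  by rewrite lte_fin; near: x; exact: nbhs_right_gt.
- move=> _; exists y; split; first exact: num_real.
  by move=> x xy; split => //; exact: ltNyr.
Unshelve. all: by end_near. Qed.

Lemma near_right_end y : I y -> \forall x \near to_right_end r, I x /\ y < x.
Proof.
move=> Iy; suff : \forall x \near to_right_end r, (x%:E < r)%E /\ y < x.
  apply: filterS => x [lx xy]; split => //; apply/andP; split => //.
  by case/andP: Iy => + _ => /lt_trans; apply; rewrite lte_fin.
case/andP: Iy => _; move: r0; case: r => [a| |] //= _.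
- rewrite lte_fin => ay; near=> x; split; last by near: x; exact: nbhs_left_gt.
  by rewrite lte_fin; near: x; exact: nbhs_left_lt.
- move=> _; exists y; split; first exact: num_real.
  by move=> x xy; split => //; exact: ltry.
Unshelve. all: by end_near. Qed.

(** Approachability speaks of a limit in the extended line. A monotone [s] either is bounded below
    and tends to its infimum, or tends to -oo, which approachability excludes. *)
Lemma approachable_l_cvg : approachable_l l s -> cvg (s x @[x --> to_left_end l]).
Proof.
move=> al; have I0 : I 0 by apply/andP.
have [[M sM]|nb] := pselect (exists M, forall x, I x -> M <= s x).
  pose m := inf (s @` I).
  have hi : has_inf (s @` I).
    by split; [exists (s 0), 0|exists M => _ [x Ix <-]; exact: sM].
  apply/cvg_ex; exists m; apply/cvgrPdist_le => e e0.
  have [_ [y Iy <-] ye] := inf_adherent e0 hi.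
  have := near_left_end Iy; apply: filterS => x [Ix xy].
  have : m <= s x by apply: ge_inf; [exact: hi.2|exists x].
  have := s_incr Ix Iy (ltW xy).
  by move: ye; rewrite -/m => ? ? ?; rewrite ler_norml; apply/andP; split; lra.
have : (s x)%:E @[x --> to_left_end l] --> -oo%E.
  apply/cvgeNyPle => A; have [y [Iy yA]] : exists y, I y /\ s y < A.
    apply: contrapT => H; apply: nb; exists A => x Ix.
    by rewrite leNgt; apply/negP => xA; apply: H; exists x.
  have := near_left_end Iy; apply: filterS => x [Ix xy].
  by rewrite lee_fin; apply: le_trans (ltW yA); apply: s_incr => //; exact: ltW.
move=> /(cvg_lim (@ereal_hausdorff _)) E.
by move: al; rewrite /approachable_l /s_at_l E.
Qed.

Lemma approachable_r_cvg : approachable_r r s -> cvg (s x @[x --> to_right_end r]).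
Proof.
move=> al; have I0 : I 0 by apply/andP.
have [[M sM]|nb] := pselect (exists M, forall x, I x -> s x <= M).
  pose m := sup (s @` I).
  have hi : has_sup (s @` I).
    by split; [exists (s 0), 0|exists M => _ [x Ix <-]; exact: sM].
  apply/cvg_ex; exists m; apply/cvgrPdist_le => e e0.
  have [_ [y Iy <-] ye] := sup_adherent e0 hi.
  have := near_right_end Iy; apply: filterS => x [Ix xy].
  have : s x <= m by apply: sup_ubound; [exact: hi.2|exists x].
  have := s_incr Iy Ix (ltW xy).
  by move: ye; rewrite -/m => ? ? ?; rewrite ler_norml; apply/andP; split; lra.
have : (s x)%:E @[x --> to_right_end r] --> +oo%E.
  apply/cvgeyPge => A; have [y [Iy yA]] : exists y, I y /\ A < s y.
    apply: contrapT => H; apply: nb; exists A => x Ix.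
    by rewrite leNgt; apply/negP => xA; apply: H; exists x.
  have := near_right_end Iy; apply: filterS => x [Ix xy].
  by rewrite lee_fin; apply: (le_trans (ltW yA)); apply: s_incr => //; exact: ltW.
move=> /(cvg_lim (@ereal_hausdorff _)) E.
by move: al; rewrite /approachable_r /s_at_r E.
Qed.

End end_filters.

(** * The set U and its components *)

Section constancy_set.
Context (R : realType) (l r : \bar R) (s : R -> R).
Local Notation I := (Iopen l r).
Hypothesis s_incr : forall x y, I x -> I y -> x <= y -> s x <= s y.

Lemma s_const_between a b y : I a -> I b -> s a = s b -> a <= y -> y <= b -> s y = s a.
Proof.
move=> Ia Ib sab ay yb; have Iy := Iopen_convex Ia Ib ay yb.
by apply: le_anti; rewrite (s_incr Ia Iy ay) {1}sab (s_incr Iy Ib yb).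
Qed.

Lemma open_ereal_itv (c d : \bar R) : open [set x | (c < x < d)%E].
Proof.
rewrite (_ : [set x | _] = [set x | (c < x)%E] `&` [set x | (x < d)%E]).
  by apply: openI; [exact: open_ereal_gt_ereal|exact: open_ereal_lt_ereal].
by apply/seteqP; split => x /=; [move/andP|move=> ?; exact/andP].
Qed.

(** By monotonicity, constancy around [x] amounts to equal values at one point on either side; this
    replaces neighbourhoods in the extended line by real points. *)
Lemma inU_realP x : I x ->
  inU l r s x%:E <-> exists a b, [/\ I a, I b, a < x, x < b & s a = s b].
Proof.
move=> Ix; split=> [[_ [N [Nx sN]]]|[a [b [Ia Ib ax xb sab]]]].
  have : \forall y \near x, N y%:E /\ I y.
    by near=> y; split; near: y; [exact: Nx|exact: nbhs_Iopen].
  move=> /nbhs_ballP[e /= e0 xe].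
  have Na : N (x - e / 2)%:E /\ I (x - e / 2).
    by apply: xe; rewrite /ball /= opprB addrC subrK ger0_norm; lra.
  have Nb : N (x + e / 2)%:E /\ I (x + e / 2).
    by apply: xe; rewrite /ball /= opprD addNKr normrN ger0_norm; lra.
  exists (x - e / 2), (x + e / 2); case: Na => Na Ia; case: Nb => Nb Ib.
  by split => //; [lra|lra|exact: sN].
split; first by case/andP: Ix => lx xr; apply/andP; split; exact: ltW.
exists [set z | (a%:E < z < b%:E)%E]; split.
  apply: open_nbhs_nbhs; split; first exact: open_ereal_itv.
  by rewrite /= !lte_fin ax xb.
move=> y z Iy /= /andP[ay yb] Iz /andP[az zb].
by rewrite !lte_fin in ay yb az zb;
  rewrite (@s_const_between a b y)// ?(@s_const_between a b z)// ltW.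
Unshelve. all: by end_near. Qed.

(* As s is monotone, the component of x0 is the interior of the level set of s. *)
Lemma component_exists x0 : I x0 -> inU l r s x0%:E -> exists c d,
  [/\ Ucomponent l r s c d, (c < x0%:E)%E, (x0%:E < d)%E &
    forall y, (c < y%:E)%E -> (y%:E < d)%E -> I y /\ s y = s x0].
Proof.
move=> Ix0 U0; pose S := EFin @` [set y | I y /\ s y = s x0].
have [a0 [b0 [Ia0 Ib0 ax0 xb0 sab0]]] := (inU_realP Ix0).1 U0.
have sa0 : s x0 = s a0 by apply: (s_const_between Ia0 Ib0); rewrite // ltW.
have Sa0 : S a0%:E by exists a0.
have Sb0 : S b0%:E by exists b0 => //; split => //; rewrite -sab0.
pose c := ereal_inf S; pose d := ereal_sup S.
have cx0 : (c < x0%:E)%E.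
  by apply: (@le_lt_trans _ _ a0%:E); [exact: ereal_inf_lbound|rewrite lte_fin].
have x0d : (x0%:E < d)%E.
  by apply: (@lt_le_trans _ _ b0%:E); [rewrite lte_fin|exact: ereal_sup_ubound].
have lc : (l <= c)%E.
  by apply: le_ereal_inf_tmp => _ [y [/andP[ly _] _] <-]; exact: ltW.
have dr : (d <= r)%E.
  by apply: ge_ereal_sup => _ [y [/andP[_ yr] _] <-]; exact: ltW.
have cd y : (c < y%:E)%E -> (y%:E < d)%E -> exists a b,
    [/\ I a, I b, a < y, y < b & s a = s x0 /\ s b = s x0].
  move=> /ereal_inf_lt[_ [a [Ia sa] <-] ay] /ereal_sup_gt[_ [b [Ib sb] <-] yb].
  by exists a, b; split => //; rewrite -lte_fin.
have cdI y : (c < y%:E)%E -> (y%:E < d)%E -> I y /\ s y = s x0.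
  move=> cy yd; have [a [b [Ia Ib ay yb [sa sb]]]] := cd y cy yd; split.
    by apply: (Iopen_convex Ia Ib); exact: ltW.
  by rewrite -sa; apply: (s_const_between Ia Ib); rewrite ?sa ?sb// ltW.
exists c, d; split => //; split => //.
- by rewrite lc (lt_trans cx0 x0d).
- move=> y /andP[cy yd]; have [a [b [Ia Ib ay yb [sa sb]]]] := cd y cy yd.
  apply/inU_realP; first exact: (cdI y cy yd).1.
  by exists a, b; split => //; rewrite sa.
(* If [c] were in U, [s] would have equal values at some a < c and at points [w] of the component,
   so [a] would belong to the level set and lie below its infimum. *)
- have [->|cl] := eqVneq c l; [by left|right => Uc].
  have lc' : (l < c)%E by rewrite lt_neqAle eq_sym cl.
  have [c' cE] : exists c', c = c'%:E.
    move: cx0 lc'; case: (c) => [c' _ _|//|_].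
      by exists c'.
    by rewrite ltNge leNye.
  have c'x0 : c' < x0 by rewrite -lte_fin -cE.
  have Ic : I c'.
    by apply/andP; rewrite -cE lc'; split => //; apply: (lt_trans cx0); case/andP: Ix0.
  rewrite cE in Uc; have [a [b [Ia Ib ac cb sab]]] := (inU_realP Ic).1 Uc.
  pose w := (c' + Num.min b x0) / 2.
  have [cm mb mx] : [/\ c' < Num.min b x0, Num.min b x0 <= b & Num.min b x0 <= x0].
    by rewrite lt_min cb c'x0 ge_min lexx ge_min lexx orbT.
  have cw : c' < w by rewrite /w; lra.
  have wx : w < x0 by rewrite /w; lra.
  have [Iw sw] : I w /\ s w = s x0.
    by apply: cdI; rewrite ?cE ?lte_fin//; apply: lt_trans x0d; rewrite lte_fin.
  have : S a%:E.
    exists a => //; split => //; rewrite -sw; apply/esym/(s_const_between Ia Ib sab).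
      by apply: ltW; exact: lt_trans cw.
    by rewrite /w; lra.
  by move=> /ereal_inf_lbound; rewrite -/c cE lee_fin leNgt ac.
- have [->|dr'] := eqVneq d r; [by left|right => Ud].
  have rd : (d < r)%E by rewrite lt_neqAle dr'.
  have [d' dE] : exists d', d = d'%:E.
    move: x0d rd; case: (d) => [d' _ _|_|//].
      by exists d'.
    by rewrite ltNge leey.
  have x0d' : x0 < d' by rewrite -lte_fin -dE.
  have Id : I d'.
    by apply/andP; rewrite -dE rd; split => //; apply: lt_trans x0d; case/andP: Ix0.
  rewrite dE in Ud; have [a [b [Ia Ib ad db sab]]] := (inU_realP Id).1 Ud.
  pose w := (d' + Num.max a x0) / 2.
  have [cm mb mx] : [/\ Num.max a x0 < d', a <= Num.max a x0 & x0 <= Num.max a x0].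
    by rewrite gt_max ad x0d' le_max lexx le_max lexx orbT.
  have wd : w < d' by rewrite /w; lra.
  have xw : x0 < w by rewrite /w; lra.
  have [Iw sw] : I w /\ s w = s x0.
    by apply: cdI; rewrite ?dE ?lte_fin//; apply: (lt_trans cx0); rewrite lte_fin.
  have : S b%:E.
    exists b => //; split => //; rewrite -sw -sab;
      apply/esym/(s_const_between Ia Ib sab).
      by rewrite /w; lra.
    by apply: ltW; exact: lt_trans db.
  by move=> /ereal_sup_ubound; rewrite -/d dE lee_fin leNgt db.
Qed.

(** If the left point is in U, its component must end by the right one, where [s] has another value;
    this end lies inside the interval and so outside U. *)
Lemma exists_not_inU : (exists x y, [/\ I x, I y & s x <> s y]) ->
  exists2 x, I x & ~ inU l r s x%:E.
Proof.
move=> [x [y [Ix Iy sxy]]]; wlog xy : x y Ix Iy sxy / x <= y.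
  move=> W; case: (leP x y) => [|/ltW] xy; first exact: (W x y).
  by apply: (W y x) => //; exact/nesym.
have [Ux|] := pselect (inU l r s x%:E); last by exists x.
have [c [d [[cd dr _ _ Hd] cx xd sE]]] := component_exists Ix Ux.
have dy : (d <= y%:E)%E.
  rewrite leNgt; apply/negP => yd; apply: sxy; apply/esym.
  by apply: (sE y _ yd).2; apply: (lt_le_trans cx); rewrite lee_fin.
have yr : (y%:E < r)%E by case/andP: Iy.
case: Hd => [E|nd]; first by move: (le_lt_trans dy yr); rewrite E ltxx.
have [d' dE] : exists d', d = d'%:E by move: xd dy; case: (d) => [d' _ _|_|//] //;
  exists d'.
exists d'; last by rewrite -dE.
by rewrite dE in xd dy; apply: (Iopen_convex Ix Iy); rewrite -lee_fin // ltW.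
Qed.

End constancy_set.

(** * Functions of S in the zero class of m *)

Section vanishing.
Context (R : realType) (l r : \bar R) (s : R -> R)
  (muc mup mum mi : {measure set R -> \bar R}) (ml mr : \bar R).
Hypothesis sm : scale_measures l r s muc mup mum.
Local Notation I := (Iopen l r).
Local Notation L := (layered_sum muc mup mum).
Let s_incr := scale_incr sm.
Hypothesis ml0 : (0 <= ml)%E.
Hypothesis mr0 : (0 <= mr)%E.
Hypothesis hDK : forall c d, Ucomponent l r s c d -> isolated_comp l r s c d ->
  (c = l -> reflecting_l l r s mi ml) /\ (d = r -> reflecting_r l r s mi mr).
Hypothesis nonU_supp :
  forall x, Iclosed l r x -> ~ inU l r s x -> in_suppI l r mi ml mr x.
Hypothesis Dzero_pos : forall x, Dzero l r s x -> (0 < mi [set x])%E.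
Hypothesis isolated_pos : forall c d, Ucomponent l r s c d ->
  isolated_comp l r s c d -> (0 < measI l r mi ml mr (Icd l r s c d))%E.

(** The support condition, tested on a neighbourhood that avoids [l] and [r], so that the boundary
    atoms do not contribute. *)
Lemma nonU_mass a b x : I a -> I b -> a < x -> x < b -> ~ inU l r s x%:E ->
  (0 < mi [set t | (a < t < b)%R])%E.
Proof.
move=> Ia Ib ax xb nU; have Ix := Iopen_convex Ia Ib (ltW ax) (ltW xb).
have Icx : Iclosed l r x%:E by case/andP: Ix => lx xr; apply/andP; split; exact: ltW.
have [_ /(_ [set z | (a%:E < z < b%:E)%E])] := nonU_supp Icx nU.
have -> : measI l r mi ml mr [set z | (a%:E < z < b%:E)%E] = mi [set t | (a < t < b)%R].
  have [/andP[la ar] /andP[lb br]] := (Ia, Ib).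
  rewrite /measI; case: asboolP => [/= /andP[al _]|_].
    by move: (lt_trans la al); rewrite ltxx.
  case: asboolP => [/= /andP[_ rb]|_].
    by move: (lt_trans br rb); rewrite ltxx.
  rewrite !adde0; congr (mi _); apply/seteqP; split => t /=; rewrite !lte_fin;
    first by case.
  by move=> /[dup] H /andP[at' tb]; split => //; apply: (Iopen_convex Ia Ib);
    exact: ltW.
apply; apply: open_nbhs_nbhs; split; first exact: open_ereal_itv.
by rewrite /= !lte_fin ax.
Qed.

Variables (f : R -> R) (F : R * nat -> R).
Hypothesis F2 : isL2 L setT F.
Hypothesis fF : has_density L I (@cell R) f F.
Hypothesis f_ae0 : aeqI0 l r s mi ml mr f (fun=> 0).

(** [S] is covered by a null set, and as an interval it is measurable. *)
Lemma null_of_neq0 S : is_interval S -> S `<=` I -> (forall x, S x -> f x <> 0) ->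
  mi S = 0%E.
Proof.
move=> iS SI Sf; apply: measure_negligible; first exact: is_interval_measurable.
have [[N [mN N0 NN]] _ _] := f_ae0; exists N; split => // x Sx.
by apply: NN => /= /(_ (SI x Sx)); exact: Sf.
Qed.

Lemma f_eq_of_s_eq x y : I x -> I y -> s x = s y -> f x = f y.
Proof.
move=> Ix Iy sxy; have := dens_abs_bound sm F2 fF Ix Iy.
rewrite sxy subrr normr0 mul0r => H; apply/eqP; rewrite eq_sym -subr_eq0 -sqrf_eq0.
by rewrite eq_le H sqr_ge0.
Qed.

(** If f(y) = 0, the energy bound gives f(x)^2 <= |s(y) - s(x)| q(F), which the threshold makes less
    than f(x)^2. *)
Lemma neq0_near x y : I x -> I y -> f x <> 0 ->
  `|s y - s x| <= f x ^+ 2 / (ip2 L setT F F + 1) / 2 -> f y <> 0.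
Proof.
move=> Ix Iy /eqP fx0 sxy fy0; have := dens_abs_bound sm F2 fF Ix Iy.
rewrite fy0 sub0r sqrrN; set Q := ip2 _ _ _ _ in sxy *.
have Q0 : 0 <= Q := ip2_ge0 _ _ _.
have f2 : 0 < f x ^+ 2 by rewrite exprn_even_gt0.
apply/negP; rewrite -ltNge; apply: (@le_lt_trans _ _ (f x ^+ 2 / (Q + 1) / 2 * Q)).
  exact: ler_wpM2r.
have -> : f x ^+ 2 / (Q + 1) / 2 * Q = f x ^+ 2 * (Q / (Q + 1)) / 2.
  by field; rewrite gt_eqF// ltr_wpDl.
have q1 : Q / (Q + 1) <= 1 by rewrite ler_pdivrMr ?ltr_wpDl// mul1r; lra.
nra.
Qed.

Lemma neq0_right x : I x -> s x = sright s x -> f x <> 0 ->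
  exists b, [/\ I b, x < b & forall y, x <= y -> y <= b -> f y <> 0].
Proof.
move=> Ix sx fx; pose e := f x ^+ 2 / (ip2 L setT F F + 1) / 2.
have e0 : 0 < e.
  rewrite /e !divr_gt0// ?ltr_wpDl ?ip2_ge0//.
  by rewrite exprn_even_gt0//; apply/eqP.
have [b [Ib xb sb]] := sright_approx s_incr Ix e0; exists b; split => // y xy yb.
have Iy := Iopen_convex Ix Ib xy yb; apply: (neq0_near Ix Iy fx).
have := s_incr Ix Iy xy; have := s_incr Iy Ib yb.
rewrite -/e; rewrite -sx in sb; move=> H1 H2; rewrite ger0_norm ?subr_ge0//; lra.
Qed.

Lemma neq0_left x : I x -> s x = sleft s x -> f x <> 0 ->
  exists a, [/\ I a, a < x & forall y, a <= y -> y <= x -> f y <> 0].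
Proof.
move=> Ix sx fx; pose e := f x ^+ 2 / (ip2 L setT F F + 1) / 2.
have e0 : 0 < e.
  rewrite /e !divr_gt0// ?ltr_wpDl ?ip2_ge0//.
  by rewrite exprn_even_gt0//; apply/eqP.
have [b [Ib xb sb]] := sleft_approx s_incr Ix e0; exists b; split => // y xy yb.
have Iy := Iopen_convex Ib Ix xy yb; apply: (neq0_near Ix Iy fx).
have := s_incr Ib Iy xy; have := s_incr Iy Ix yb.
rewrite -/e; rewrite -sx in sb; move=> H1 H2; rewrite ler0_norm ?subr_le0//; lra.
Qed.

Lemma no_neq0_around x a b : I a -> I b -> a < x -> x < b -> ~ inU l r s x%:E ->
  (forall y, a < y -> y < b -> f y <> 0) -> False.
Proof.
move=> Ia Ib ax xb nU fn0; have := nonU_mass Ia Ib ax xb nU.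
rewrite null_of_neq0 ?ltxx//.
- by move=> u v /andP[au ub] /andP[av vb] z /andP[uz zv];
  rewrite /= (lt_le_trans au uz) (le_lt_trans zv vb).
- by move=> t /andP[at' tb]; apply: (Iopen_convex Ia Ib); exact: ltW.
- by move=> t /andP[]; exact: fn0.
Qed.

Lemma s_eq_at_left_end c x w : I c -> I x -> c < x -> s c = sright s c ->
  (forall y, c < y -> y <= x -> s y = w) -> s c = w.
Proof.
move=> Ic Ix cx sc sw; apply: le_anti; rewrite sc; apply/andP; split.
  by rewrite -(sw x)//; exact: (sright_le s_incr).
apply/ler_addgt0Pr => e e0; have [b [Ib cb sb]] := sright_approx s_incr Ic e0.
apply: le_trans sb; rewrite -(sw (Num.min b x)).
- apply: s_incr => //; last by rewrite ge_min lexx.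
  by rewrite /Num.min; case: ifP.
- by rewrite lt_min cb.
- by rewrite ge_min lexx orbT.
Qed.

Lemma s_eq_at_right_end d x w : I d -> I x -> x < d -> s d = sleft s d ->
  (forall y, x <= y -> y < d -> s y = w) -> s d = w.
Proof.
move=> Id Ix xd sd sw; apply: le_anti; rewrite sd; apply/andP; split; last first.
  by rewrite -(sw x)//; exact: (sleft_ge s_incr).
apply/ler_addgt0Pr => e e0; have [b [Ib bd sb]] := sleft_approx s_incr Id e0.
rewrite -lerBlDr; apply: (le_trans sb); rewrite -(sw (Num.max b x)).
- apply: s_incr => //; last by rewrite le_max lexx.
  by rewrite /Num.max; case: ifP.
- by rewrite le_max lexx orbT.
- by rewrite gt_max bd.
Qed.

Lemma vanish_inU x0 : I x0 -> inU l r s x0%:E -> f x0 = 0.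
Proof.
move=> I0 U0; apply: contrapT => fx0.
have [c [d [UC cx0 x0d sE]]] := component_exists s_incr I0 U0.
have [/andP[lc cd] dr _ Hc Hd] := UC.
have fE y : (c < y%:E)%E -> (y%:E < d)%E -> f y = f x0.
  by move=> cy yd; have [Iy sy] := sE y cy yd; exact: f_eq_of_s_eq.
(* Without a right jump at [c], [s] and hence [f] keep their component values at [c]. *)
have fc c' : c = c'%:E -> I c' -> ~ eDplus l r s c -> f c' = f x0.
  move=> cE Ic nD; rewrite cE lte_fin in cx0; apply: f_eq_of_s_eq => //.
  apply: (s_eq_at_left_end Ic I0 cx0) => [|y cy yx].
    by apply: contrapT => H; apply: nD; exists c'.
  by apply: (sE _ _ _).2; rewrite ?cE ?lte_fin//; apply: le_lt_trans x0d;
    rewrite lee_fin.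
have fd d' : d = d'%:E -> I d' -> ~ eDminus l r s d -> f d' = f x0.
  move=> dE Id nD; rewrite dE lte_fin in x0d; apply: f_eq_of_s_eq => //.
  apply: (s_eq_at_right_end Id I0 x0d) => [|y xy yd].
    by apply: contrapT => H; apply: nD; exists d'.
  by apply: (sE _ _ _).2; rewrite ?dE ?lte_fin//; apply: (lt_le_trans cx0);
    rewrite lee_fin.
(* Otherwise [c] is an interior continuity point of [s] outside U. Then [f] is non-zero on both
   sides of [c], although [m] charges every neighbourhood of [c]. *)
have isoc : c = l \/ c = r \/ eDplus l r s c \/ eDminus l r s c.
  apply: contrapT => /not_orP[cl /not_orP[_ /not_orP[nP nM]]].
  have [//|nUc] := Hc.
  have lc' : (l < c)%E by rewrite lt_neqAle lc andbT; apply/eqP => E; apply: cl.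
  have [c' cE] : exists c', c = c'%:E.
    move: cx0 lc'; case: (c) => [c' _ _|//|_]; first by exists c'.
    by rewrite ltNge leNye.
  have Ic : I c'.
    by apply/andP; rewrite -cE lc'; split => //; apply: (lt_trans cx0); case/andP: I0.
  have fc' : f c' <> 0 by rewrite (fc c' cE Ic nP).
  have [|a [Ia ac fa]] := neq0_left Ic _ fc'.
    by apply: contrapT => H; apply: nM; exists c'.
  rewrite cE in nUc cx0; apply: (no_neq0_around Ia I0 ac cx0 nUc) => y ay yx.
  case: (leP y c') => [|cy]; first exact/fa/ltW.
  by rewrite fE ?cE ?lte_fin//; apply: lt_trans x0d; rewrite lte_fin.
have isod : d = l \/ d = r \/ eDplus l r s d \/ eDminus l r s d.
  apply: contrapT => /not_orP[_ /not_orP[dr' /not_orP[nP nM]]].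
  have [//|nUd] := Hd.
  have rd : (d < r)%E by rewrite lt_neqAle dr andbT; apply/eqP => E; apply: dr'.
  have [d' dE] : exists d', d = d'%:E.
    move: x0d rd; case: (d) => [d' _ _|_|//]; first by exists d'.
    by rewrite ltNge leey.
  have Id : I d'.
    by apply/andP; rewrite -dE rd; split => //; apply: lt_trans x0d; case/andP: I0.
  have fd' : f d' <> 0 by rewrite (fd d' dE Id nM).
  have [|b [Ib db fb]] := neq0_right Id _ fd'.
    by apply: contrapT => H; apply: nP; exists d'.
  rewrite dE in nUd x0d; apply: (no_neq0_around I0 Ib x0d db nUd) => y xy yb.
  case: (leP d' y) => [dy|yd]; first exact/fb/ltW.
  by rewrite fE ?dE ?lte_fin//; apply: (lt_trans cx0); rewrite lte_fin.
(* The component is isolated, so (DM) gives positive mass to a set on whose part inside (l, r) [f]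
   does not vanish; it remains to exclude the boundary atoms. *)
have := isolated_pos UC (conj isoc isod).
rewrite /measI null_of_neq0; last first.
- move=> y [Iy]; case=> [/andP[cy yd]|[[cE nD]|[dE nD]]].
  + by rewrite fE.
  + by rewrite (fc y).
  + by rewrite (fd y).
- by move=> y [].
- move=> x z [Ix Cx] [Iz Cz] y /andP[xy yz].
  have [<-//|xNy] := eqVneq x y; have [->//|yNz] := eqVneq y z.
  have {xNy}xy : x < y by rewrite lt_neqAle xNy.
  have {yNz}yz : y < z by rewrite lt_neqAle yNz.
  split; first by apply: (Iopen_convex Ix Iz); exact: ltW.
  left; apply/andP; split.
    apply: (@le_lt_trans _ _ x%:E); last by rewrite lte_fin.
    case: Cx => [/andP[/ltW]//|[[->//]|[xd _]]].
    by rewrite xd; exact: ltW.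
  apply: (@lt_le_trans _ _ z%:E); first by rewrite lte_fin.
  case: Cz => [/andP[_ /ltW]//|[[zc _]|[->//]]].
  by rewrite zc; exact: ltW.
have [_ fl fr] := f_ae0.
have cst_lim (FF : set_system R) (PF : ProperFilter FF) :
    (\forall x \near FF, f x = f x0) -> lim (f x @[x --> FF]) = f x0.
  by move=> H; apply: cvg_lim => //; apply: cvg_near_cst.
have l0 := l_lt0 sm; have r0 := r_gt0 sm.
(* If [l] is in the set then [c] is [l], which (DK) makes reflecting. A positive atom would force
   f(l) = 0, while [f] equals [f x0] near [l]. *)
have zl : (if `[< Icd l r s c d l >] then ml else 0%E) = 0%E.
  case: asboolP => // Il; apply/eqP; rewrite eq_le ml0 andbT leNgt; apply/negP => mlp.
  have cl : l = c.
    case: Il => [/andP[cl _]|[[//]|[ld _]]].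
      by move: (le_lt_trans lc cl); rewrite ltxx.
    by move: (le_lt_trans lc cd); rewrite ld ltxx.
  have rl := (hDK UC (conj isoc isod)).1 (esym cl).
  have := fl rl mlp; rewrite /f_at_l (@cst_lim _ (to_left_end_proper l)).
    by rewrite lim_cst.
  apply: filterS (near_left_end l0 I0) => x [Ix xx0].
  apply: fE; first by rewrite -cl; case/andP: Ix.
  by apply: lt_trans x0d; rewrite lte_fin.
have zr : (if `[< Icd l r s c d r >] then mr else 0%E) = 0%E.
  case: asboolP => // Ir; apply/eqP; rewrite eq_le mr0 andbT leNgt; apply/negP => mrp.
  have dr' : r = d.
    case: Ir => [/andP[_ rd]|[[rc _]|[//]]].
      by move: (lt_le_trans rd dr); rewrite ltxx.
    by move: (lt_le_trans cd dr); rewrite rc ltxx.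
  have rr := (hDK UC (conj isoc isod)).2 (esym dr').
  have := fr rr mrp; rewrite /f_at_r (@cst_lim _ (to_right_end_proper r)).
    by rewrite lim_cst.
  apply: filterS (near_right_end r0 I0) => x [Ix xx0].
  apply: fE; last by rewrite -dr'; case/andP: Ix.
  by apply: (lt_trans cx0); rewrite lte_fin.
by rewrite zl zr !adde0 ltxx.
Qed.

(** Let f(x) be non-zero with [x] outside U. If [s] is continuous on one side at [x], then [f] is
    non-zero on an interval on that side; this interval avoids U by [vanish_inU], so [m] charges it.
    If [s] jumps on both sides, (DM) charges [x] itself. *)
Lemma density_vanishing x : I x -> f x = 0.
Proof.
move=> Ix; have [|nU] := pselect (inU l r s x%:E); first exact: vanish_inU.
apply: contrapT => fx0.
have [sl|sl] := pselect (s x = sleft s x).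
  have [a [Ia ax fa]] := neq0_left Ix sl fx0; pose m := (a + x) / 2.
  have [am mx] : a < m /\ m < x by rewrite /m; split; lra.
  have Im : I m by apply: (Iopen_convex Ia Ix); exact: ltW.
  apply: (no_neq0_around Ia Ix am mx) => [Um|y ay yx]; last by apply: fa; exact: ltW.
  by apply: (fa m); rewrite ?ltW//; exact: vanish_inU.
have [sr|sr] := pselect (s x = sright s x).
  have [a [Ia ax fa]] := neq0_right Ix sr fx0; pose m := (a + x) / 2.
  have [am mx] : m < a /\ x < m by rewrite /m; split; lra.
  have Im : I m by apply: (Iopen_convex Ix Ia); exact: ltW.
  apply: (no_neq0_around Ix Ia mx am) => [Um|y ay yx]; last by apply: fa; exact: ltW.
  by apply: (fa m); rewrite ?ltW//; exact: vanish_inU.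
have : (0 < mi [set x])%E by apply: Dzero_pos; split.
rewrite null_of_neq0 ?ltxx//.
- by move=> u v -> -> z /andP[uz zv] /=; apply: le_anti; rewrite uz zv.
- by move=> _ ->.
- by move=> _ ->.
Qed.

End vanishing.

(** * The form *)

Section vanishing_sequences.
Context (R : realType).
Implicit Types a b : nat -> R.

(** One-sided on purpose: upper bounds suffice to prove it, and for non-negative sequences it is
    convergence to 0. *)
Definition vanishes a := forall e, 0 < e -> exists N, forall n, (N <= n)%N -> a n <= e.

Lemma vanishes_le a b : (forall n, a n <= b n) -> vanishes b -> vanishes a.
Proof. by move=> ab vb e /vb[N NP]; exists N => n /NP; exact: le_trans. Qed.

Lemma vanishesD a b : vanishes a -> vanishes b -> vanishes (fun n => a n + b n).
Proof.
move=> va vb e e0; have e2 : 0 < e / 2 by rewrite divr_gt0.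
have [N NP] := va _ e2; have [N' N'P] := vb _ e2; exists (N + N')%N => n nN.
have := NP n (leq_trans (leq_addr _ _) nN); have := N'P n (leq_trans (leq_addl _ _) nN).
by lra.
Qed.

Lemma vanishesM k a : 0 <= k -> vanishes a -> vanishes (fun n => k * a n).
Proof.
move=> k0 va e e0; have k1 : 0 < k + 1 by rewrite ltr_wpDl.
have [N NP] := va _ (divr_gt0 e0 k1); exists N => n /NP.
rewrite ler_pdivlMr// => H; case: (leP (a n) 0) => a0; last by nra.
by apply: le_trans (ltW e0); rewrite mulr_ge0_le0.
Qed.

Lemma vanishes_cvg a : (forall n, 0 <= a n) -> vanishes a -> a @ \oo --> 0.
Proof.
move=> a0 va; apply/cvgrPdist_le => e /va[N NP]; exists N => // n /= /NP.
by rewrite sub0r normrN ger0_norm.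
Qed.

Lemma vanishes_sqr_cvg a (c : R) : vanishes (fun n => (a n - c) ^+ 2) -> a @ \oo --> c.
Proof.
move=> va; apply/cvgrPdist_le => e e0; have [N NP] := va _ (exprn_gt0 2 e0).
exists N => // n /= /NP; rewrite distrC -[X in X <= _]real_normK ?num_real//.
by rewrite ler_pXn2r ?nnegrE// ltW.
Qed.

Lemma sqr_cauchy_vanishes a :
  (forall e, 0 < e -> exists N, forall n k, (N <= n)%N -> (N <= k)%N ->
     (a n - a k) ^+ 2 <= e) ->
  exists c, vanishes (fun n => (a n - c) ^+ 2).
Proof.
move=> ca; have cva : cvgn a.
  apply/cauchy_cvgP; apply: cauchy_exP => e e0.
  have e2 : 0 < (e / 2) ^+ 2 by rewrite exprn_gt0// divr_gt0.
  have [N NP] := ca _ e2; exists (a N); exists N => // n /= Nn.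
  have := NP N n (leqnn _) Nn; rewrite -[X in X <= _]real_normK ?num_real//.
  rewrite ler_pXn2r ?nnegrE// ?divr_ge0 ?(ltW e0)// /ball /=.
  by move=> /le_lt_trans; apply; lra.
(* A distance of at most 1 dominates its own square, so a bound by [e] passes to the square. *)
exists (limn a) => e e0; have d0 : 0 < Num.min 1 e by rewrite lt_min ltr01.
have /cvgrPdist_le/(_ _ d0)[N _ NP] := cva; exists N => n /NP /=.
rewrite le_min distrC => /andP[h1 h2]; rewrite -[leLHS]real_normK ?num_real//.
by apply: le_trans h2; rewrite expr2; have := normr_ge0 (a n - limn a); nra.
Qed.

End vanishing_sequences.

(** * Linearity, symmetry and the Markov property *)

Section form.
Context (R : realType) (l r : \bar R) (s : R -> R)
  (muc mup mum mi : {measure set R -> \bar R}) (ml mr : \bar R).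
Hypothesis sm : scale_measures l r s muc mup mum.
Local Notation I := (Iopen l r).
Local Notation L := (layered_sum muc mup mum).
Local Notation L2 := (isL2 L setT).
Local Notation q f := (ip2 L setT f f).
Local Notation dens := (has_density L I (@cell R)).
Local Notation E := (energyE l r muc mup mum).
Local Notation ip := (ipI0 l r s mi ml mr).
Local Notation dom := (domF l r s mi ml mr muc mup mum).
Let s_incr := scale_incr sm.
Let I0 := Iopen0 sm.
Let mI := measurable_Iopen l r.
Hypothesis ml0 : (0 <= ml)%E.
Hypothesis mr0 : (0 <= mr)%E.

Lemma cvg_at_l f F : approachable_l l s -> L2 F -> dens f F ->
  f x @[x --> to_left_end l] --> f_at_l l f.
Proof.
move=> al F2 fF; apply: (density_cvg (PF := to_left_end_proper l) sm _ _ F2 fF).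
- by apply: filterS (near_left_end (l_lt0 sm) I0) => x [].
- exact: approachable_l_cvg (l_lt0 sm) (r_gt0 sm) s_incr al.
Qed.

Lemma cvg_at_r f F : approachable_r r s -> L2 F -> dens f F ->
  f x @[x --> to_right_end r] --> f_at_r r f.
Proof.
move=> ar F2 fF; apply: (density_cvg (PF := to_right_end_proper r) sm _ _ F2 fF).
- by apply: filterS (near_right_end (r_gt0 sm) I0) => x [].
- exact: approachable_r_cvg (l_lt0 sm) (r_gt0 sm) s_incr ar.
Qed.

Lemma f_at_l_lin a f g F G : approachable_l l s -> L2 F -> L2 G -> dens f F ->
  dens g G ->
  f_at_l l (fun x => a * f x + g x) = a * f_at_l l f + f_at_l l g.
Proof.
move=> al F2 G2 fF gG; have P := to_left_end_proper l.
apply: cvg_lim => //; apply: cvgD; last exact: cvg_at_l gG.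
by apply: cvgM; [exact: cvg_cst|exact: cvg_at_l fF].
Qed.

Lemma f_at_r_lin a f g F G : approachable_r r s -> L2 F -> L2 G -> dens f F ->
  dens g G ->
  f_at_r r (fun x => a * f x + g x) = a * f_at_r r f + f_at_r r g.
Proof.
move=> ar F2 G2 fF gG; have P := to_right_end_proper r.
apply: cvg_lim => //; apply: cvgD; last exact: cvg_at_r gG.
by apply: cvgM; [exact: cvg_cst|exact: cvg_at_r fF].
Qed.

Lemma dom_density f : dom f -> exists F, L2 F /\ dens f F.
Proof. by case=> /(inS_density sm)[F F2 fF] _ _ _; exists F. Qed.

Lemma dom_lin a f g : dom f -> dom g -> dom (fun x => a * f x + g x).
Proof.
move=> Df Dg; have [F [F2 fF]] := dom_density Df; have [G [G2 gG]] := dom_density Dg.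
case: Df => _ fL fl fr; case: Dg => _ gL gl gr; split.
- apply/(inS_density sm); exists (fun t => a * F t + G t); first exact: isL2_lin.
  exact: (dens_lin sm).
- exact: (isL2_lin mI a fL gL).
- by move=> al nl; rewrite (f_at_l_lin a al F2 G2 fF gG) fl// gl// mulr0 addr0.
- by move=> ar nr; rewrite (f_at_r_lin a ar F2 G2 fF gG) fr// gr// mulr0 addr0.
Qed.

Lemma domB f g : dom f -> dom g -> dom (fun x => f x - g x).
Proof.
move=> Df Dg; have := dom_lin (-1) Dg Df.
by rewrite (_ : (fun x => -1 * g x + f x) = (fun x => f x - g x))//; apply/funext =>
  x; ring.
Qed.

Lemma dom0 : dom (fun=> 0).
Proof.
split; [|exact: isL20| |].
- by apply/(inS_density sm); exists (fun=> 0); [exact: isL20|exact: dens0].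
- by move=> _ _; have P := to_left_end_proper l; apply: cvg_lim => //; exact: cvg_cst.
- by move=> _ _; have P := to_right_end_proper r; apply: cvg_lim => //; exact: cvg_cst.
Qed.

Lemma energyE_sqr f F : L2 F -> dens f F -> E f f = 2^-1 * q F.
Proof. by move=> F2 fF; exact: (energyE_density sm). Qed.

Lemma energy_lin a f g h : dom f -> dom g -> dom h ->
  E (fun x => a * f x + g x) h = a * E f h + E g h.
Proof.
move=> /dom_density[F [F2 fF]] /dom_density[G [G2 gG]] /dom_density[H [H2 hH]].
have D2 : L2 (fun t => a * F t + G t) by exact: isL2_lin.
rewrite (energyE_density sm D2 H2 (dens_lin sm a F2 G2 fF gG) hH).
rewrite (energyE_density sm F2 H2 fF hH) (energyE_density sm G2 H2 gG hH).
by rewrite ip2_lin//; ring.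
Qed.

Lemma energyC f g : dom f -> dom g -> E f g = E g f.
Proof.
move=> /dom_density[F [F2 fF]] /dom_density[G [G2 gG]].
by rewrite (energyE_density sm F2 G2 fF gG) (energyE_density sm G2 F2 gG fF) ip2C.
Qed.

Lemma energy_ge0 f : dom f -> 0 <= E f f.
Proof.
by move=> /dom_density[F [F2 fF]]; rewrite (energyE_sqr F2 fF) mulr_ge0// ip2_ge0.
Qed.

Lemma unit_contraction (a b : R) :
  `|Num.min (Num.max 0 a) 1 - Num.min (Num.max 0 b) 1| <= `|a - b|.
Proof.
rewrite ler_norml; have := ler_norm (a - b); have := ler_norm (b - a);
  rewrite (distrC b).
move: (`|a - b|) (normr_ge0 (a - b)) => z z0.
by rewrite /Num.min /Num.max; case: ifPn; case: ifPn; case: ifPn; case: ifPn;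
  rewrite -?leNgt => *; apply/andP; split; lra.
Qed.

(** The truncation itself serves as [v]: it is a contraction of [u], so it has a density of no
    larger norm. As it fixes 0, |v| <= |u|, which gives square integrability and the zero boundary
    values. *)
Lemma energy_markov u : dom u -> exists2 v, dom v &
  aeqI0 l r s mi ml mr v (fun x => Num.min (Num.max 0 (u x)) 1) /\ E v v <= E u u.
Proof.
move=> Du; have [G [G2 uG]] := dom_density Du.
pose v x := Num.min (Num.max 0 (u x)) 1.
have vu x y : I x -> I y -> `|v y - v x| <= `|u y - u x| by move=> _ _;
  exact: unit_contraction.
have [G' [G'2 vG' qq]] := has_density_contraction (@measurable_cell R) (@cellU R)
  (fun x y z _ _ => @cellI R x y z) (cell_measure sm) G2 uG vu.
have v0 x : `|v x| <= `|u x|.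
  have m0 : Num.min (Num.max 0 0) 1 = 0 :> R by rewrite maxxx; apply/min_idPl.
  by have := unit_contraction (u x) 0; rewrite m0 !subr0.
case: Du => _ uL ul ur; exists v; last split.
- split.
  + by apply/(inS_density sm); exists G'.
  + have [mu _] := uL; apply: (isL2_le mI _ _ uL) => //.
    apply: measurable_minr; last exact: measurable_cst.
    by apply: measurable_maxr => //; exact: measurable_cst.
  + move=> al nl; have P := to_left_end_proper l; apply: cvg_lim => //.
    have := cvg_at_l al G2 uG; rewrite ul// => /cvgrPdist_le H.
    apply/cvgrPdist_le => e /H; apply: filterS => x; rewrite !sub0r !normrN.
    exact: le_trans.
  + move=> al nl; have P := to_right_end_proper r; apply: cvg_lim => //.
    have := cvg_at_r al G2 uG; rewrite ur// => /cvgrPdist_le H.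
    apply/cvgrPdist_le => e /H; apply: filterS => x; rewrite !sub0r !normrN.
    exact: le_trans.
- by split => //; exact: aeW.
- by rewrite (energyE_sqr G'2 vG') (energyE_sqr G2 uG) ler_pM2l ?invr_gt0.
Qed.

End form.

(** * Closedness *)

Section closedness.
Context (R : realType) (l r : \bar R) (s : R -> R)
  (muc mup mum mi : {measure set R -> \bar R}) (ml mr : \bar R).
Hypothesis sm : scale_measures l r s muc mup mum.
Local Notation I := (Iopen l r).
Local Notation L := (layered_sum muc mup mum).
Local Notation L2 := (isL2 L setT).
Local Notation q f := (ip2 L setT f f).
Local Notation dens := (has_density L I (@cell R)).
Local Notation E := (energyE l r muc mup mum).
Local Notation ip := (ipI0 l r s mi ml mr).
Local Notation dom := (domF l r s mi ml mr muc mup mum).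
Let s_incr := scale_incr sm.
Let I0 := Iopen0 sm.
Let mI := measurable_Iopen l r.
Hypothesis ml0 : (0 <= ml)%E.
Hypothesis mr0 : (0 <= mr)%E.

Lemma ipI0_sqr_bounds w : [/\ ip2 mi I w w <= ip w w, 0 <= ip w w &
  ip w w = ip2 mi I w w
   + (if `[< reflecting_l l r s mi ml >] then f_at_l l w * f_at_l l w * fine ml else 0)
   + (if `[< reflecting_r l r s mi mr >] then f_at_r r w * f_at_r r w * fine mr else
     0)].
Proof.
have bl : 0 <= if `[< reflecting_l l r s mi ml >] then f_at_l l w * f_at_l l w * fine
  ml else 0.
  by case: ifP => // _; rewrite mulr_ge0 ?fine_ge0// -expr2 sqr_ge0.
have br : 0 <= if `[< reflecting_r l r s mi mr >] then f_at_r r w * f_at_r r w * fine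
  mr else 0.
  by case: ifP => // _; rewrite mulr_ge0 ?fine_ge0// -expr2 sqr_ge0.
have w0 := ip2_ge0 mi I w; rewrite /ipI0 -/(ip2 mi I w w); split => //; lra.
Qed.

Lemma sqr_le_at0 w W x : L2 W -> dens w W -> I x ->
  w x ^+ 2 <= 2 * w 0 ^+ 2 + 2 * (`|s x| * q W).
Proof.
move=> W2 wW Ix; have := dens_abs_bound sm W2 wW I0 Ix.
have [_ -> _] := scale0 sm; rewrite subr0.
(* 2 p0^2 + 2 (p - p0)^2 - p^2 is the square of p - 2 p0. *)
by have := sqr_ge0 (w x - 2 * w 0); move: (w x) (w 0) => p p0; nra.
Qed.

Lemma lim_sqr_le_at0 (FF : set_system R) (PF : ProperFilter FF) w W :
  FF I -> cvg (s x @[x --> FF]) -> L2 W -> dens w W ->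
  lim (w x @[x --> FF]) ^+ 2 <=
    2 * w 0 ^+ 2 + 2 * (`|lim (s x @[x --> FF])| * q W).
Proof.
move=> FI sF W2 wW; have := density_lim_bound (PF := PF) sm FI sF W2 wW I0.
have [_ -> _] := scale0 sm; rewrite subr0.
move: (`|_| * q W) (lim (w x @[x --> FF])) (w 0) => z p p0 H.
by have := sqr_ge0 (p - 2 * p0); nra.
Qed.

Lemma ip2_subset A w : measurable A -> A `<=` I -> isL2 mi I w ->
  Rintegral mi A (fun x => w x ^+ 2) <= ip2 mi I w w.
Proof.
move=> mA AI w2; have i2 := isL2_sqr w2.
apply: fine_le.
- exact: (integrable_fin_num mA (integrableS mI mA AI i2)).
- exact: (integrable_fin_num mI i2).
- apply: ge0_subset_integral => //; first by case/integrableP: i2.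
  by move=> x _; rewrite lee_fin sqr_ge0.
Qed.

(** Average w(0)^2 <= 2 w(x)^2 + 2 |s(x)| q(W) over the points [x] of an interval of positive finite
    mass [m], on which |s| is at most [K]; this gives the constants 2 / m and 2 K. *)
Lemma at0_bound a b : I a -> I b -> a < b ->
  (0 < mi [set t | (a < t < b)%R] < +oo)%E ->
  exists C K : R, [/\ 0 <= C, 0 <= K & forall w W, L2 W -> dens w W -> isL2 mi I w ->
    w 0 ^+ 2 <= C * ip2 mi I w w + K * q W].
Proof.
move=> Ia Ib ab /andP[m0 moo]; set S := [set t | _] in m0 moo.
have SE : S = `]a, b[%classic by apply/seteqP; split => t /=; rewrite in_itv.
have mS : measurable S by rewrite SE; exact: measurable_itv.
have SI : S `<=` I.
  by move=> t /andP[at' tb]; apply: (Iopen_convex Ia Ib); exact: ltW.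
pose m := fine (mi S); have mp : 0 < m by rewrite fine_gt0// m0.
pose K := `|s a| + `|s b|.
have Kb t : S t -> `|s t| <= K.
  move=> St; have It := SI t St; case/andP: St => at' tb.
  have := s_incr Ia It (ltW at'); have := s_incr It Ib (ltW tb).
  have := ler_norm (s b); have := ler_norm (- s a); rewrite normrN.
  have := normr_ge0 (s a); have := normr_ge0 (s b).
  by rewrite /K => *; rewrite ler_norml; apply/andP; split; lra.
exists (2 / m), (2 * K); split.
- by rewrite divr_ge0// ltW.
- by rewrite mulr_ge0// addr_ge0.
move=> w W W2 wW w2.
have ic (c : R) : mi.-integrable S (EFin \o (fun=> c)).
  apply/integrableP; split; first exact/measurable_EFinP/measurable_cst.
  have -> : (\int[mi]_(x in S) `|(EFin \o (fun=> c)) x| = \int[mi]_(x in S)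
    cst `|c|%:E x)%E by [].
  by rewrite integral_cst// lte_mul_pinfty.
have iw : mi.-integrable S (EFin \o (fun x => w x ^+ 2)).
  exact: integrableS mI mS SI (isL2_sqr w2).
have Q0 := ip2_ge0 L setT W.
have H : Rintegral mi S (fun=> w 0 ^+ 2) <=
    Rintegral mi S (fun x => 2 * w x ^+ 2 + 2 * K * q W).
  apply: (le_Rintegral mS (ic _)).
    exact: (integrableD mS (integrableZl mS 2 iw) (ic (2 * K * q W))).
  move=> x Sx; have Ix := SI x Sx; have := dens_abs_bound sm W2 wW I0 Ix.
  have [_ -> _] := scale0 sm; rewrite subr0.
  have := Kb x Sx; have := sqr_ge0 (w 0 - 2 * w x).
  move: (w 0) (w x) (`|s x|) => p p0 z; nra.
rewrite RintegralD// ?RintegralZl// ?Rintegral_cst// in H;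
  last exact: (integrableZl mS 2 iw).
have := ip2_subset mS SI w2; rewrite -/m in H => H'.
rewrite -(ler_pM2r mp) mulrDl (_ : 2 / m * _ * m = 2 * ip2 mi I w w); last first.
  by field; rewrite gt_eqF.
by lra.
Qed.

Lemma from_zero_cell_density G c : L2 G ->
  dens (fun x => c + from_zero (fun a b => Rintegral L (cell a b) G) x) G.
Proof.
move=> G2 x y Ix Iy xy; rewrite opprD addrACA subrr add0r.
apply: (from_zeroB (A := I)) => // a b d Ia Ib Id ab bd.
exact: (cell_split (@measurable_cell R) (@cellU R)
  (fun x y z _ _ => @cellI R x y z) (cell_measure sm)).
Qed.

Hypothesis charged : exists a b, [/\ I a, I b, a < b &
  (0 < mi [set t | (a < t < b)%R] < +oo)%E].

Lemma form_closed (u : nat -> R -> R) : (forall n, dom (u n)) ->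
  (forall e, 0 < e -> exists N, forall n k, (N <= n)%N -> (N <= k)%N ->
     E (fun x => u n x - u k x) (fun x => u n x - u k x)
     + ip (fun x => u n x - u k x) (fun x => u n x - u k x) < e) ->
  exists2 v, dom v &
    (fun n => E (fun x => u n x - v x) (fun x => u n x - v x)
              + ip (fun x => u n x - v x) (fun x => u n x - v x)) @ \oo --> 0.
Proof.
move=> Du cu; have [a [b [Ia Ib ab mab]]] := charged.
have [C [K [C0 K0 bound0]]] := at0_bound Ia Ib ab mab.
have [G GP] := choice (fun n => dom_density sm (Du n)).
have G2 n : L2 (G n) by case: (GP n).
have uG n : dens (u n) (G n) by case: (GP n).
have u2 n : isL2 mi I (u n) by case: (Du n).
have D2 n k : L2 (fun t => G n t - G k t) by exact: isL2B.
have Dd n k : dens (fun x => u n x - u k x) (fun t => G n t - G k t)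
  by exact: (densB sm).
have Du2 n k : isL2 mi I (fun x => u n x - u k x) by exact: isL2B.
(* The tolerance is halved because the energy is half of [q]. *)
have both e : 0 < e -> exists N, forall n k, (N <= n)%N -> (N <= k)%N ->
    q (fun t => G n t - G k t) <= e /\
    ip2 mi I (fun x => u n x - u k x) (fun x => u n x - u k x) <= e.
  move=> e0; have e2 : 0 < e / 2 by rewrite divr_gt0.
  have [N NP] := cu _ e2; exists N => n k Nn Nk; have := NP n k Nn Nk.
  rewrite (energyE_sqr sm (D2 n k) (Dd n k)).
  have [H1 H2 _] := ipI0_sqr_bounds (fun x => u n x - u k x).
  have Q0 := ip2_ge0 L setT (fun t => G n t - G k t).
  by move=> H; split; lra.
have [G0 G02 GG0] : exists2 G0, L2 G0 & vanishes (fun n => q (fun t => G n t - G0 t)).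
  apply: L2_complete => // e /both[N NP]; exists N => n k Nn Nk.
  by case: (NP n k Nn Nk).
(* The densities determine the functions up to a constant; [at0_bound] makes the values at 0
   converge as well. *)
have [c uc] : exists c, vanishes (fun n => (u n 0 - c) ^+ 2).
  apply: sqr_cauchy_vanishes => e e0.
  have CK : 0 < C + K + 1 by rewrite ltr_wpDl// addr_ge0.
  have [N NP] := both _ (divr_gt0 e0 CK); exists N => n k Nn Nk.
  have [H1 H2] := NP n k Nn Nk.
  apply: le_trans (bound0 _ _ (D2 n k) (Dd n k) (Du2 n k)) _.
  rewrite !ler_pdivlMr// in H1 H2.
  have := ip2_ge0 L setT (fun t => G n t - G k t).
  have := ip2_ge0 mi I (fun x => u n x - u k x).
  move: H1 H2; move: (ip2 L _ _ _) (ip2 mi _ _ _) => X Y; nra.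
(* The limit is built from its density and its value at 0, so it belongs to S by construction. *)
pose v x := c + from_zero (fun a b => Rintegral L (cell a b) G0) x.
have vG0 : dens v G0 := from_zero_cell_density c G02.
have v0 : v 0 = c.
  rewrite /v /from_zero lexx (cellxx (fun x y z _ _ => @cellI R x y z)).
  by rewrite Rintegral_set0 addr0.
have W2 n : L2 (fun t => G n t - G0 t) by exact: isL2B.
have Wd n : dens (fun x => u n x - v x) (fun t => G n t - G0 t) by exact: (densB sm).
have small k1 : 0 <= k1 -> vanishes (fun n => 2 * (u n 0 - v 0) ^+ 2
    + 2 * (k1 * q (fun t => G n t - G0 t))).
  move=> k10; apply: vanishesD; apply: vanishesM => //; first by rewrite v0.
  exact: vanishesM.
have ptw x : I x -> u n x @[n --> \oo] --> v x.
  move=> Ix; apply: vanishes_sqr_cvg; apply: vanishes_le (small _ (normr_ge0 (s x)))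
    => n.
  exact: sqr_le_at0 (W2 n) (Wd n) Ix.
(* Fatou's lemma in the second index, with the first one fixed. *)
have fat e N : (forall n k, (N <= n)%N -> (N <= k)%N ->
    ip2 mi I (fun x => u n x - u k x) (fun x => u n x - u k x) <= e) ->
  forall n, (N <= n)%N -> isL2 mi I (fun x => u n x - v x) /\
    ip2 mi I (fun x => u n x - v x) (fun x => u n x - v x) <= e.
  move=> NP n Nn; apply: (isL2_fatou mI (f_ := fun k x => u n x - u k x)) => //.
  - by move=> x Ix; apply: cvgB; [exact: cvg_cst|exact: ptw].
  - by exists N => // k /= Nk; exact: NP.
have v2 : isL2 mi I v.
  have [N NP] := both _ (@ltr01 R).
  have [|H _] := @fat 1 N _ N (leqnn _); first by move=> n k Nn Nk;
    case: (NP n k Nn Nk).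
  have := isL2B mI (u2 N) H.
  by rewrite (_ : (fun x => u N x - (u N x - v x)) = v)//; apply/funext => x; ring.
have at_l : approachable_l l s -> vanishes (fun n => f_at_l l (fun x => u n x - v x)
  ^+ 2).
  move=> al; apply: vanishes_le (small _ (normr_ge0 (lim (s x @[x -->
    to_left_end l])))) => n.
  apply: (lim_sqr_le_at0 (to_left_end_proper l)) => //.
    by apply: filterS (near_left_end (l_lt0 sm) I0) => x [].
  exact: approachable_l_cvg (l_lt0 sm) (r_gt0 sm) s_incr al.
have at_r : approachable_r r s -> vanishes (fun n => f_at_r r (fun x => u n x - v x)
  ^+ 2).
  move=> al; apply: vanishes_le (small _ (normr_ge0 (lim (s x @[x -->
    to_right_end r])))) => n.
  apply: (lim_sqr_le_at0 (to_right_end_proper r)) => //.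
    by apply: filterS (near_right_end (r_gt0 sm) I0) => x [].
  exact: approachable_r_cvg (l_lt0 sm) (r_gt0 sm) s_incr al.
have eq0_of_vanishes (z : R) : vanishes (fun=> z ^+ 2) -> z = 0.
  move=> vz; apply/eqP; rewrite -sqrf_eq0 eq_le sqr_ge0 andbT.
  by apply/ler_addgt0Pr => e /vz[N /(_ N (leqnn _))]; rewrite add0r.
have Dv : dom v.
  split => //.
  - by apply/(inS_density sm); exists G0.
  (* Each [u n] has boundary value 0, so the boundary value of u_n - v is the constant -v(l), while
     its square vanishes in the limit. *)
  - move=> al nl; apply: eq0_of_vanishes; apply: vanishes_le (at_l al) => n.
    have := f_at_l_lin sm (-1) al G02 (G2 n) vG0 (uG n).
    rewrite (_ : (fun x => -1 * v x + u n x) = (fun x => u n x - v x)); last first.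
      by apply/funext => x; ring.
    move=> ->; have [_ _ H _] := Du n; rewrite H// addr0 mulN1r sqrrN//.
  - move=> ar nr; apply: eq0_of_vanishes; apply: vanishes_le (at_r ar) => n.
    have := f_at_r_lin sm (-1) ar G02 (G2 n) vG0 (uG n).
    rewrite (_ : (fun x => -1 * v x + u n x) = (fun x => u n x - v x)); last first.
      by apply/funext => x; ring.
    move=> ->; have [_ _ _ H] := Du n; rewrite H// addr0 mulN1r sqrrN//.
exists v => //; apply: vanishes_cvg => [n|].
  have [_ H _] := ipI0_sqr_bounds (fun x => u n x - v x).
  by rewrite addr_ge0//; apply: (energy_ge0 sm); exact: (domB sm).
apply: vanishesD.
  apply: vanishes_le (vanishesM (k := 2^-1) _ GG0); last by rewrite invr_ge0.
  by move=> n; rewrite (energyE_sqr sm (W2 n) (Wd n)).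
apply: (@vanishes_le _ _ (fun n => ip2 mi I (fun x => u n x - v x) (fun x =>
  u n x - v x)
   + (if `[< reflecting_l l r s mi ml >] then fine ml * f_at_l l (fun x =>
     u n x - v x) ^+ 2 else 0)
   + (if `[< reflecting_r l r s mi mr >] then fine mr * f_at_r r (fun x =>
     u n x - v x) ^+ 2 else 0))).
  move=> n; have [_ _ ->] := ipI0_sqr_bounds (fun x => u n x - v x).
  by rewrite !(mulrC (fine _)) !expr2.
have zero : vanishes (fun=> 0 : R) by move=> e e0; exists 0%N => n _; exact: ltW.
apply: vanishesD; first apply: vanishesD.
- move=> e /both[N NP]; exists N => n Nn.
  have NP' n' k : (N <= n')%N -> (N <= k)%N ->
    ip2 mi I (fun x => u n' x - u k x) (fun x => u n' x - u k x) <= e.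
    by move=> h1 h2; case: (NP n' k h1 h2).
  by case: (fat e N NP' n Nn).
- case: asboolP => [[[al _] _]|_] //; apply: vanishesM; first exact: fine_ge0.
  exact: at_l.
- case: asboolP => [[[ar _] _]|_] //; apply: vanishesM; first exact: fine_ge0.
  exact: at_r.
Qed.

End closedness.

(** * The five clauses of a Dirichlet form in the wide sense *)

Theorem theorem2p4 (R : realType) (l r : \bar R)
  (hl : (l < 0)%E) (hr : (0 < r)%E)
  (* the scale function s on (l, r) *)
  (s : R -> R)
  (hs_incr : forall x y, Iopen l r x -> Iopen l r y -> x <= y -> s x <= s y)
  (hs_nonconst : exists x y, [/\ Iopen l r x, Iopen l r y & s x <> s y])
  (hs0 : [/\ sleft s 0 = 0, s 0 = 0 & sright s 0 = 0])
  (* the measure m on I = [l, r]: restriction mi to (l, r), atoms ml, mr *)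
  (mi : {measure set R -> \bar R}) (ml mr : \bar R)
  (hml : (0 <= ml)%E) (hmr : (0 <= mr)%E)
  (hmi_out : mi (~` Iopen l r) = 0%E)
  (hmi_loc : forall a b, Iopen l r a -> Iopen l r b ->
     (mi [set x | (a <= x <= b)%R] < +oo)%E)
  (hmi0 : mi [set 0] = 0%E)
  (* standing assumption (DK) *)
  (hDK : forall c d, Ucomponent l r s c d -> isolated_comp l r s c d ->
     (c = l -> reflecting_l l r s mi ml) /\ (d = r -> reflecting_r l r s mi mr))
  (* standing assumption (DM) *)
  (hDM : [/\ (forall x, Iclosed l r x -> ~ inU l r s x -> in_suppI l r mi ml mr x),
            (forall x, Dzero l r s x -> (0 < mi [set x])%E) &
            (forall c d, Ucomponent l r s c d -> isolated_comp l r s c d ->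
               (0 < measI l r mi ml mr (Icd l r s c d))%E)])
  (* the measures mu_d^+, mu_d^- and mu_c *)
  (mup mum muc : {measure set R -> \bar R})
  (hmup : forall A, measurable A ->
     mup A = (\esum_(x in A `&` Iopen l r) (sright s x - s x)%:E)%E)
  (hmum : forall A, measurable A ->
     mum A = (\esum_(x in A `&` Iopen l r) (s x - sleft s x)%:E)%E)
  (hmuc_out : muc (~` Iopen l r) = 0%E)
  (hmuc : forall a b, Iopen l r a -> Iopen l r b -> a < b ->
     muc [set x | (a < x <= b)%R] = (s_cont s mup mum b - s_cont s mup mum a)%:E) :
  dirichlet_form_wide
    (domF l r s mi ml mr muc mup mum)
    (energyE l r muc mup mum)
    (L2I0 l r mi)
    (ipI0 l r s mi ml mr)
    (aeqI0 l r s mi ml mr).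
Proof.
have sm : scale_measures l r s muc mup mum by [].
have I0 := Iopen0 sm; case: hDM => nonU_supp Dzero_pos isolated_pos.
(* As [s] is not constant, some interior point lies outside U and hence in the support of [m]; local
   finiteness bounds the mass around it. *)
have charged : exists a b, [/\ Iopen l r a, Iopen l r b, a < b &
    (0 < mi [set t | (a < t < b)%R] < +oo)%E].
  have [x Ix nU] := exists_not_inU hs_incr hs_nonconst.
  have [a Ia ax] := Iopen_lt Ix; have [b Ib xb] := Iopen_gt Ix.
  exists a, b; split => //; first exact: lt_trans xb.
  apply/andP; split; first exact: (nonU_mass nonU_supp Ia Ib ax xb nU).
  apply: (@le_lt_trans _ _ (mi [set x | (a <= x <= b)%R]) _ _ _ (hmi_loc _ _ Ia Ib)).
  apply: le_measure; rewrite ?inE.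
  - by rewrite (_ : [set t | _] = `]a, b[%classic) //; apply/seteqP; split => t /=;
    rewrite in_itv.
  - by rewrite (_ : [set t | _] = `[a, b]%classic) //; apply/seteqP; split => t /=;
    rewrite in_itv.
  - by move=> t /= /andP[at' tb]; rewrite !ltW.
split.
- split; first by move=> f [].
  by split; [exact: dom0|exact: (dom_lin sm)].
(* A function in the zero class vanishes at every point, so its density has integral 0 on all cells
   and thus norm 0. *)
- move=> f Df f0; have [F [F2 fF]] := dom_density sm Df.
  have fz := density_vanishing sm hml hmr hDK nonU_supp Dzero_pos isolated_pos F2 fF f0.
  rewrite (energyE_sqr sm F2 fF) (density_unique0 sm F2) ?mulr0// => x y Ix Iy xy.
  by rewrite -fF// !fz// subrr.
- split; first exact: (energyC sm).
  by split; [exact: (energy_lin sm)|exact: (energy_ge0 sm)].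
- exact: (form_closed sm hml hmr charged).
- exact: (energy_markov sm).
Qed.
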